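(* $\mathrm{PLA}\cap C(\mathbb{T})$ is a set of first category in $C(\mathbb{T})$ (i.e. it is a countable union of nowhere dense subsets of $C(\mathbb{T})$ in the uniform norm).
   Context: $\mathbb{T}=\mathbb{R}/2\pi\mathbb{Z}$ is the circle, and $C(\mathbb{T})$ is the Banach space of complex-valued continuous functions on $\mathbb{T}$ with the uniform norm. A function $f$ on $\mathbb{T}$ belongs to $\mathrm{PLA}$ (pointwise limits of analytic sums) if there are complex coefficients $c(n)$, $n\ge 0$, such that the series $\sum_{n\geq 0}c(n)e^{int}$ converges to $f(t)$ for almost every $t\in\mathbb{T}$ (with respect to Lebesgue measure). The coefficients $c(n)$ are not required to be the Fourier coefficients of $f$. *)

(* Defs.v *)
From HB Require Import structures.
From mathcomp Require Import all_boot all_order all_algebra.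
From mathcomp Require Import generic_quotient ring_quotient.
From mathcomp Require Import complex.
From mathcomp Require Import all_classical all_reals all_analysis.
From mathcomp Require Import measurable_realfun.
From mathcomp Require Import lra zify.

Set Implicit Arguments.
Unset Strict Implicit.
Unset Printing Implicit Defensive.

Import Order.TTheory GRing.Theory Num.Theory.
Import numFieldNormedType.Exports.
Import Normc.

Local Open Scope classical_set_scope.
Local Open Scope ring_scope.
Local Open Scope complex_scope.
Local Open Scope quotient_scope.

(* The libraries provide no topology on the concrete type R[i]; it is given here
   the one of the modulus, which every numFieldType carries. *)
HB.instance Definition _ (R : realType) := NormedModule.copy R[i] R[i]^o.

Definition twopi_int (R : realType) : {pred R} :=
  [pred x : R | `[< exists k : int, x = k%:~R * (2 * pi) >]].
Arguments twopi_int R : clear implicits.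

Lemma twopi_intP (R : realType) (x : R) :
  reflect (exists k : int, x = k%:~R * (2 * pi)) (x \in twopi_int R).
Proof. exact: asboolP. Qed.

Lemma twopi_int_zmod_closed (R : realType) : zmod_closed (twopi_int R).
Proof.
split; first by apply/twopi_intP; exists 0; rewrite mul0r.
move=> _ _ /twopi_intP[k ->] /twopi_intP[l ->].
by apply/twopi_intP; exists (k - l); rewrite rmorphB mulrBl.
Qed.

HB.instance Definition _ (R : realType) :=
  GRing.isZmodClosed.Build R (twopi_int R) (twopi_int_zmod_closed R).

(* The circle R / 2 pi Z: a quotient group, with the quotient topology. *)
Definition circle (R : realType) : Type :=
  quotient_topology (Quotient.quot (twopi_int R)).

HB.instance Definition _ (R : realType) := Topological.on (circle R).
HB.instance Definition _ (R : realType) := Quotient.on (circle R).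
HB.instance Definition _ (R : realType) := Pointed.on (circle R).

Section circle_theory.
Variable R : realType.
Notation T := (circle R).

Definition toT (x : R) : T := \pi_T x.

Lemma toT_continuous : continuous toT.
Proof. exact: pi_continuous. Qed.

Lemma toT_eq (x y : R) :
  toT x = toT y <-> exists k : int, x = y + k%:~R * (2 * pi).
Proof.
have E : toT x = toT y <-> x - y \in twopi_int R.
  by rewrite Quotient.idealrBE; split=> [h|/eqP h]; [apply/eqP; exact: h|].
apply: (iff_trans E); split.
  by move=> /twopi_intP[k hk]; exists k; rewrite -hk addrC subrK.
case=> k ->; apply/twopi_intP; exists k.
by rewrite addrAC subrr add0r.
Qed.

Lemma toT_surj (t : T) : exists2 x, 0 <= x < 2 * pi & toT x = t.
Proof.
have pi2 : 0 < 2 * pi :> R by rewrite mulr_gt0 ?pi_gt0.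
pose y := repr t; pose k := Num.floor (y / (2 * pi)).
exists (y - k%:~R * (2 * pi)); last first.
  rewrite -[RHS]reprK; apply/toT_eq; exists (- k).
  by rewrite rmorphN mulNr.
have /andP[h1 h2] := real_floor_itv (num_real (y / (2 * pi))).
rewrite subr_ge0 -ler_pdivlMr// h1/= ltrBlDl -[X in _ + X]mul1r -mulrDl.
by rewrite -ltr_pdivrMr// (lt_le_trans h2)// rmorphD.
Qed.

End circle_theory.
Arguments toT {R} x.

Section normc_theory.
Variable R : realType.
Implicit Types z w : R[i].

Lemma normcE z : `|z| = (normc z)%:C.
Proof. by []. Qed.

Lemma normc_ge0 z : 0 <= normc z.
Proof. by case: z => a b; exact: sqrtr_ge0. Qed.

Lemma normcD z w : normc (z + w) <= normc z + normc w.
Proof. by have := ler_normD z w; rewrite !normcE -rmorphD/= lecR. Qed.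

Lemma normc_continuous : continuous (@normc R).
Proof.
move=> z; apply/(@cvgrPdist_lt _ _ _ (nbhs z) (nbhs_filter z)) => e e0.
have e0' : 0 < e%:C by rewrite ltcR.
have := nbhsx_ballx z _ e0'.
apply: filterS => w; rewrite -ball_normE /ball_/= normcE ltcR.
apply: le_lt_trans.
have h (a b : R[i]) : normc a - normc b <= normc (a - b).
  by rewrite lerBlDr; apply: le_trans (normcD _ _); rewrite subrK.
by rewrite ler_norml h andbT lerNl opprB -(normcN (z - w)) opprB h.
Qed.

End normc_theory.

(* C(T). Its norm, as a normed module over R[i], has to take values in R[i]: it is
   the real number unorm f = sup_t |f t|, embedded in R[i]. The sup is that of a
   bounded set, see CT_has_sup. *)
Definition CT (R : realType) : Type := continuousType (circle R) R[i].

Section CT.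
Variable R : realType.
Notation T := (circle R).
Notation CT := (CT R).

HB.instance Definition _ := Choice.on CT.

Definition CT_fun (f : CT) : T -> R[i] := Continuous.sort f.
Coercion CT_fun : CT >-> Funclass.

Definition mkCT (f : T -> R[i]) (cf : continuous f) : CT :=
  [the continuousType T R[i] of mkcts cf].

Lemma CT_continuous (f : CT) : continuous (f : T -> R[i]).
Proof. exact: cts_fun. Qed.

Lemma CT_ext (f g : CT) : (forall t, f t = g t) -> f = g.
Proof. by move=> fg; apply/continuousEP => t; exact: fg. Qed.

Lemma CT_has_sup (f : CT) : has_sup (range (fun t : T => normc (f t))).
Proof.
split; first by exists (normc (f point)), point.
have [] := @EVT_max R (fun x => normc (f (toT x))) 0 (2 * pi).
- by rewrite mulr_ge0 ?pi_ge0.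
- apply: continuous_subspaceT => x.
  apply: (@continuous_comp _ _ _ (fun x => f (toT x))); last exact: normc_continuous.
  by apply: continuous_comp; [exact: toT_continuous|exact: CT_continuous].
move=> c _ fc; exists (normc (f (toT c))) => _ [t _ <-].
have [x /andP[x0 x1] <-] := toT_surj t.
by apply: fc; rewrite in_itv/= x0 ltW.
Qed.

Definition unorm (f : CT) : R := sup (range (fun t : T => normc (f t))).

Lemma le_unorm (f : CT) t : normc (f t) <= unorm f.
Proof. by apply: sup_upper_bound; [exact: CT_has_sup|exists t]. Qed.

Lemma unorm_le (f : CT) (M : R) : (forall t, normc (f t) <= M) -> unorm f <= M.
Proof.
move=> fM; apply: ge_sup; first exact: (CT_has_sup f).1.
by move=> _ [t _ <-].
Qed.

Lemma CT_addP (f g : CT) : continuous (fun t => f t + g t).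
Proof.
move=> t; apply: (@cvgD _ _ _ (nbhs t) (nbhs_filter t)); exact: CT_continuous.
Qed.

Lemma CT_oppP (f : CT) : continuous (fun t => - f t).
Proof.
move=> t; apply: (@cvgN _ _ _ (nbhs t) (nbhs_filter t)); exact: CT_continuous.
Qed.

Lemma CT_scaleP (a : R[i]) (f : CT) : continuous (fun t => a * f t).
Proof.
move=> t; apply: (@cvgM _ _ (nbhs t) (nbhs_filter t)).
  exact: cst_continuous.
exact: CT_continuous.
Qed.

Definition CT_zero : CT := mkCT (@cst_continuous T R[i] 0).
Definition CT_add (f g : CT) : CT := mkCT (@CT_addP f g).
Definition CT_opp (f : CT) : CT := mkCT (@CT_oppP f).
Definition CT_scale (a : R[i]) (f : CT) : CT := mkCT (@CT_scaleP a f).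

Fact CT_addA : associative CT_add.
Proof. by move=> f g h; apply: CT_ext => t; exact: addrA. Qed.
Fact CT_addC : commutative CT_add.
Proof. by move=> f g; apply: CT_ext => t; exact: addrC. Qed.
Fact CT_add0 : left_id CT_zero CT_add.
Proof. by move=> f; apply: CT_ext => t; exact: add0r. Qed.
Fact CT_addN : left_inverse CT_zero CT_opp CT_add.
Proof. by move=> f; apply: CT_ext => t; exact: addNr. Qed.
HB.instance Definition _ :=
  GRing.isZmodule.Build CT CT_addA CT_addC CT_add0 CT_addN.

Fact CT_scaleA a b f : CT_scale a (CT_scale b f) = CT_scale (a * b) f.
Proof. by apply: CT_ext => t; exact: mulrA. Qed.
Fact CT_scale1 : left_id 1 CT_scale.
Proof. by move=> f; apply: CT_ext => t; exact: mul1r. Qed.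
Fact CT_scaleDr : right_distributive CT_scale +%R.
Proof. by move=> a f g; apply: CT_ext => t; exact: mulrDr. Qed.
Fact CT_scaleDl f : {morph CT_scale^~ f : a b / a + b}.
Proof. by move=> a b; apply: CT_ext => t; exact: mulrDl. Qed.
HB.instance Definition _ := GRing.Zmodule_isLmodule.Build R[i] CT
  CT_scaleA CT_scale1 CT_scaleDr CT_scaleDl.

Fact unormD (f g : CT) : (unorm (f + g))%:C <= (unorm f)%:C + (unorm g)%:C.
Proof.
rewrite -rmorphD lecR; apply: unorm_le => t; apply: le_trans (normcD _ _) _.
by rewrite lerD ?le_unorm.
Qed.

Fact unormZ_le (a : R[i]) (f : CT) : unorm (a *: f) <= normc a * unorm f.
Proof.
apply: unorm_le => t; rewrite [X in normc X](_ : _ = a * f t)// normcM.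
by rewrite ler_wpM2l ?normc_ge0 ?le_unorm.
Qed.

Fact unormZ (a : R[i]) (f : CT) : (unorm (a *: f))%:C = `|a| * (unorm f)%:C.
Proof.
have -> : `|a| * (unorm f)%:C = (normc a * unorm f)%:C by rewrite rmorphM.
congr _%:C; apply/le_anti; rewrite unormZ_le/=.
have [->|a0] := eqVneq a 0.
  by rewrite normc0 mul0r; apply: le_trans (le_unorm _ point); exact: normc_ge0.
have na0 : 0 < normc a.
  rewrite lt_def normc_ge0 andbT; apply: contra_neq a0; exact: eq0_normc.
rewrite -ler_pdivlMl// -normcV; apply: le_trans (unormZ_le _ _).
by rewrite scalerA mulVf// scale1r.
Qed.

Fact unorm_eq0 (f : CT) : (unorm f)%:C = 0 -> f = 0.
Proof.
move=> /complexI f0; apply: CT_ext => t; apply: eq0_normc; apply/le_anti.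
by rewrite normc_ge0 andbT -f0 le_unorm.
Qed.

HB.instance Definition _ := Lmodule_isNormed.Build R[i] CT
  unormD unormZ unorm_eq0.

Lemma CT_normE (f : CT) : `|f| = (unorm f)%:C.
Proof. by []. Qed.

End CT.

(* The quotient sigma-algebra on the circle. Together with circle_measure below, the
   image of Lebesgue measure on [0, 2 pi[, it gives "almost every t" its usual
   meaning, see ae_circleP. *)
Definition circle_measurable (R : realType) : set_system (circle R) :=
  [set A | measurable (@toT R @^-1` A : set (measurableTypeR R))].

Fact circle_display : measure_display. Proof. by []. Qed.

Section circle_measure.
Variable R : realType.
Notation T := (circle R).

Fact circle_measurable0 : circle_measurable (set0 : set T).
Proof. by rewrite /circle_measurable/= preimage_set0. Qed.
Fact circle_measurableC (A : set T) :
  circle_measurable A -> circle_measurable (~` A).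
Proof. by rewrite /circle_measurable/= preimage_setC; exact: measurableC. Qed.
Fact circle_measurable_bigcup (F : (set T)^nat) :
  (forall i, circle_measurable (F i)) -> circle_measurable (\bigcup_i F i).
Proof.
move=> mF; rewrite /circle_measurable/= preimage_bigcup.
by apply: bigcupT_measurable => i; exact: mF.
Qed.

HB.instance Definition _ := isMeasurable.Build circle_display T
  circle_measurable0 circle_measurableC circle_measurable_bigcup.

Lemma measurable_toT :
  measurable_fun [set: measurableTypeR R] (@toT R : measurableTypeR R -> T).
Proof. by move=> _ A mA; rewrite setTI. Qed.

Fact circle_itv_measurable : measurable (`[0, 2 * pi[%classic : set (measurableTypeR R)).
Proof. exact: measurable_itv. Qed.

Definition circle_measure : set T -> \bar R :=
  pushforward (mrestr (@lebesgue_measure R) circle_itv_measurable) (@toT R).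

HB.instance Definition _ := Measure.copy circle_measure
  (measure_function_pushforward__canonical__measure_function_Measure
     (mrestr (@lebesgue_measure R) circle_itv_measurable) measurable_toT).

Lemma ae_circleP (P : T -> Prop) :
  {ae circle_measure, forall t, P t} <->
  {ae @lebesgue_measure R, forall x, x \in `[0, 2 * pi[ -> P (toT x)}.
Proof.
pose I : set (measurableTypeR R) := `[0, 2 * pi[%classic.
have mI : measurable I by exact: measurable_itv.
split=> -[A [mA A0 PA]].
  exists (toT @^-1` A `&` I); split; [exact: measurableI|exact: A0|].
  move=> x /= /not_implyP[xI Px]; split; last exact: xI.
  by apply: (PA (toT x)).
pose B : set T := [set t | exists2 x, (A `&` I) x & toT x = t].
have BI : toT @^-1` B `&` I `<=` A.
  move=> x [[y [Ay Iy] /toT_eq[k yE]] Ix].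
  have pi2 : 0 < 2 * pi :> R by rewrite mulr_gt0 ?pi_gt0.
  move: Ix Iy; rewrite /I /= !in_itv/= => /andP[x0 x1] /andP[y0 y1].
  suff k0 : k = 0 by move: Ay; rewrite yE k0 mul0r addr0.
  have : k < 1.
    rewrite -(ltr_int R) -(ltr_pM2r pi2) mul1r.
    by move: y1 x0; rewrite yE; lra.
  have : -1 < k.
    rewrite -(ltr_int R) rmorphN1 -(ltr_pM2r pi2) mulN1r.
    by move: y0 x1; rewrite yE; lra.
  by move: k {yE} => k; lia.
have mB : measurable (toT @^-1` B : set (measurableTypeR R)).
  have -> : toT @^-1` B =
      \bigcup_(m : nat) ((fun x => x + m%:R * (2 * pi)) @^-1` (A `&` I) `|`
                         (fun x => x - m%:R * (2 * pi)) @^-1` (A `&` I)).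
    apply/seteqP; split=> [x [y AIy /toT_eq[[m|m] yE]]|x [m _ [AIx|AIx]]].
    - by exists m => //; left; rewrite /= -yE.
    - exists m.+1 => //; right; rewrite /=.
      by move: yE; rewrite NegzE mulrNz mulNr => <-.
    - by exists (x + m%:R * (2 * pi)) => //; apply/toT_eq; exists m.
    - exists (x - m%:R * (2 * pi)) => //; apply/toT_eq; exists (- m%:Z).
      by rewrite mulrNz mulNr.
  apply: bigcupT_measurable => m; apply: measurableU;
    rewrite -[X in measurable X]setTI;
    (apply: (_ : measurable_fun setT _) => //; last exact: measurableI).
  - by apply: continuous_measurable_fun => x; apply: cvgD; [exact: cvg_id|exact: cvg_cst].
  - by apply: continuous_measurable_fun => x; apply: cvgB; [exact: cvg_id|exact: cvg_cst].
exists B; split; first exact: mB.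
- apply: (@subset_measure0 _ _ _ (@lebesgue_measure R) _ A) => //.
  exact: measurableI.
- move=> t /= Pt; have [x x01 xt] := toT_surj t.
  exists x => //; split; last by rewrite /I/= in_itv.
  by apply: PA => /= H; apply: Pt; rewrite -xt; apply: H; rewrite in_itv.
Qed.

End circle_measure.

Section PLA.
Variable R : realType.
Notation T := (circle R).

(* exp(i n t). It does not depend on the representative of t, see expi_toT. *)
Definition expi (n : nat) (t : T) : R[i] :=
  let x : R := repr t in cos (n%:R * x) +i* sin (n%:R * x).

Lemma periodicz (f : R -> R) (p : R) : periodic f p ->
  forall (k : int) a, f (a + k%:~R * p) = f a.
Proof.
move=> fp [k|k] a; first by rewrite -pmulrn mulr_natl (periodicn fp).
rewrite NegzE mulrNz mulNr -pmulrn mulr_natl -(periodicn fp k.+1 (a - _)).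
by rewrite subrK.
Qed.

Lemma expi_toT n x : expi n (toT x) = cos (n%:R * x) +i* sin (n%:R * x) :> R[i].
Proof.
have [k xE] : exists k : int, repr (toT x) = x + k%:~R * (2 * pi).
  by apply/toT_eq; exact: reprK.
rewrite /expi/= xE mulrDr mulrA -[n%:R]/(n%:Z%:~R) -intrM.
rewrite (_ : 2 * pi = pi *+ 2) ?mulr_natl//.
by rewrite (periodicz (@cosD2pi R)) (periodicz (@sinD2pi R)).
Qed.

(* series u is the sequence of partial sums of u, so the limit is that of
   \sum_(0 <= k < N) c k * exp(i k t) as N grows. Nothing relates c to the Fourier
   coefficients of f, and f need not be continuous or even measurable. *)
Definition PLA : set (T -> R[i]) :=
  [set f | exists c : nat -> R[i],
    {ae @circle_measure R, forall t,
      series (fun n => c n * expi n t) @ \oo --> f t}].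

End PLA.
Arguments PLA R : clear implicits.

Definition nowhere_dense (X : topologicalType) (A : set X) : Prop :=
  interior (closure A) = set0.

Definition first_category (X : topologicalType) (A : set X) : Prop :=
  exists F : (set X)^nat,
    (forall n, nowhere_dense (F n)) /\ A = \bigcup_n F n.

(* Main.v *)
Require Import Defs.
From mathcomp Require Import all_boot all_order all_algebra.
From mathcomp Require Import all_classical all_reals all_analysis.
From mathcomp Require Import complex measurable_realfun.
From mathcomp Require Import ring lra.

(** If the sums of c and d are bounded by M and converge to f and h off a set of
    small measure, and h is close to f + e * exp(- i t), then, for a partial sum S of
    d - c, the polynomial G(z) = z * S(z) - e is small on a set A of almost full
    measure, while |G(0)| = e.  By Abel summation G is bounded on the cones with vertex
    in A.  Averaging Poisson kernels over the arcs that miss A gives a harmonic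
    function q, with q(0) small, that is bounded below outside these cones; so
    the maximum principle for log |G| + L * (1 - q / kappa) on {q <= kappa} shows that
    |G(0)| is small, a contradiction.  Hence the class of continuous functions
    represented with a given bound M off a set of measure at most eta (eta
    absolute) is nowhere dense.  To subtract sums, one perturbs a
    function of the class itself, which is possible as the class is dense in the
    interior of its closure. *)

Set Implicit Arguments.
Unset Strict Implicit.
Unset Printing Implicit Defensive.

Import Order.TTheory GRing.Theory Num.Theory.
Import numFieldNormedType.Exports.
Import Normc.

Local Open Scope classical_set_scope.
Local Open Scope ring_scope.
Local Open Scope complex_scope.

(** * Complex numbers, Abel summation and polynomials on the disc *)

Section plane.
Variable R : realType.
Local Notation C := R[i].
Local Notation Re := complex.Re.
Local Notation Im := complex.Im.
Implicit Types (z w : C) (p : {poly C}).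

Lemma normcX z n : normc (z ^+ n) = normc z ^+ n.
Proof. by elim: n => [|n IH]; rewrite ?expr0 ?normc1// !exprS normcM IH. Qed.

Lemma normcR (x : R) : normc x%:C = `|x|.
Proof. by rewrite /= expr0n addr0 sqrtr_sqr. Qed.

Lemma normc_sub z w : normc z - normc w <= normc (z - w).
Proof. by rewrite lerBlDr; apply: le_trans (normcD _ _); rewrite subrK. Qed.

Lemma normc_subC z w : normc (z - w) = normc (w - z).
Proof. by rewrite -normcN opprB. Qed.

Lemma normc_dist z v w : normc (z - w) <= normc (z - v) + normc (v - w).
Proof. by apply: le_trans (normcD _ _); rewrite addrA subrK. Qed.

Lemma sqr_normcE z : normc z ^+ 2 = Re z ^+ 2 + Im z ^+ 2.
Proof. by case: z => a b /=; rewrite sqr_sqrtr// addr_ge0 ?sqr_ge0. Qed.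

Lemma normc_le_ReIm z : normc z <= `|Re z| + `|Im z|.
Proof.
rewrite -ler_sqr ?nnegrE ?normc_ge0 ?addr_ge0// sqr_normcE sqrrD !real_normK ?num_real//.
by rewrite -addrA lerD2l lerDr mulrn_wge0// mulr_ge0.
Qed.

Lemma Re_le_normc z : `|Re z| <= normc z.
Proof.
by rewrite -ler_sqr ?nnegrE ?normc_ge0// sqr_normcE real_normK ?num_real// lerDl sqr_ge0.
Qed.

Lemma normc_eq0 z : (normc z == 0) = (z == 0).
Proof. by apply/eqP/eqP => [/eq0_normc//|->]; exact: normc0. Qed.

Definition cis (x : R) : C := cos x +i* sin x.

Lemma normc_cis x : normc (cis x) = 1.
Proof. by rewrite /= cos2Dsin2 sqrtr1. Qed.

Lemma cisD x y : cis (x + y) = cis x * cis y.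
Proof. by rewrite /cis cosD sinD; simpc; congr (_ +i* _); rewrite addrC. Qed.

Lemma cis_muln n x : cis (n%:R * x) = cis x ^+ n.
Proof.
elim: n => [|n IH]; first by rewrite mul0r /cis cos0 sin0.
by rewrite exprS -IH -cisD mulrS mulrDl mul1r.
Qed.

Lemma cis_neq0 x : cis x != 0.
Proof. by rewrite -normc_eq0 normc_cis oner_eq0. Qed.

Lemma lip_MVT (f f' : R -> R) : (forall x, is_derive (x : R) (1 : R) f (f' x)) ->
  (forall x, `|f' x| <= 1) -> forall x y, `|f x - f y| <= `|x - y|.
Proof.
move=> df f1.
have cf : continuous f.
  by move=> x; apply: differentiable_continuous; apply/derivable1_diffP; have [] := df x.
suff H x y : x < y -> `|f y - f x| <= `|y - x|.
  move=> x y; have [xy|xy|->] := ltgtP x y; last by rewrite !subrr.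
    by rewrite distrC [leRHS]distrC; exact: H.
  exact: H.
move=> xy; have [|c _ ->] := @MVT R f f' x y xy.
  exact: continuous_subspaceT.
by rewrite normrM ler_piMl.
Qed.

Lemma cis_lip x y : normc (cis x - cis y) <= 2 * `|x - y|.
Proof.
apply: le_trans (normc_le_ReIm _) _; rewrite mulr_natl mulr2n /=.
apply: lerD.
  apply: (@lip_MVT cos (fun x => - sin x)) => t.
  by rewrite normrN sin_max.
apply: (@lip_MVT sin cos) => t; exact: cos_max.
Qed.

Lemma polar z : exists2 t, 0 <= t < 2 * pi & z = (normc z)%:C * cis t.
Proof.
have [->|z0] := eqVneq z 0.
  by exists 0; rewrite ?lexx ?mulr_gt0 ?pi_gt0// normc0 mul0r.
have nz0 : 0 < normc z by rewrite lt_def normc_ge0 normc_eq0 z0.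
set a := Re z / normc z; set b := Im z / normc z.
have zE : z = (normc z)%:C * (a +i* b).
  rewrite /a /b; simpc; rewrite !(mulrC (normc z)) !divfK ?gt_eqF//.
  by case: (z).
have ab : a ^+ 2 + b ^+ 2 = 1.
  by rewrite /a /b !expr_div_n -mulrDl -sqr_normcE divff// expf_neq0 ?gt_eqF.
have a1 : -1 <= a <= 1.
  by rewrite -ler_norml -(@expr_le1 _ 2)// real_normK ?num_real// -ab lerDl sqr_ge0.
have ca : cos (acos a) = a by apply: acosK; rewrite in_itv.
have pi0 := pi_gt0 R.
have sa : sin (acos a) = `|b|.
  by rewrite sin_acos// -ab addrAC subrr add0r sqrtr_sqr.
have a0 := acos_ge0 a1; have api := acos_lepi a1.
have [b0|b0] := leP 0 b.
  exists (acos a); first by rewrite a0/=; lra.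
  by rewrite /cis ca sa ger0_norm.
exists (2 * pi - acos a).
  rewrite subr_ge0; apply/andP; split; first by lra.
  (* The angle [2 * pi] is excluded: [acos a = 0] would force [b = 0]. *)
  rewrite ltrBlDr ltrDl lt_def a0 andbT; apply: contraTneq b0 => e.
  by move: sa; rewrite e sin0 => /eqP; rewrite eq_sym normr_eq0 => /eqP ->; rewrite ltxx.
have -> : 2 * pi - acos a = - acos a + pi *+ 2 by rewrite addrC mulr_natl.
by rewrite /cis cosD2pi sinD2pi cosN sinN ca sa ltr0_norm// opprK.
Qed.

(** In [analytic_gap] the two bounds absorb the two terms of the distance
    [n.+1%:R^-1 + (1 - normc z)]. *)
Lemma geo_sum_le (r : R) n : 0 <= r <= 1 ->
  \sum_(i < n) r ^+ i <= n%:R /\ (1 - r) * \sum_(i < n) r ^+ i <= 1.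
Proof.
move=> /andP[r0 r1]; split.
  rewrite -[n in n%:R]card_ord -sumr_const; apply: ler_sum => i _.
  exact: exprn_ile1.
have -> : (1 - r) * \sum_(i < n) r ^+ i = 1 - r ^+ n.
  by rewrite -opprB mulNr -subrX1 opprB.
by rewrite gerBl exprn_ge0.
Qed.

(** Summation by parts in [w = z / cis s], where [normc (1 - w)] is the distance from [z] to
    [cis s]. When this distance is comparable to [1 - normc z], the bound does not depend on [n]. *)
Lemma abel_bound (c : nat -> C) (n : nat) (M s : R) z : normc z <= 1 -> 0 <= M ->
  (forall k, normc (\sum_(i < k) c i * cis s ^+ i) <= M) ->
  normc (\sum_(i < n) c i * z ^+ i) <=
    M * (1 + normc (cis s - z) * \sum_(i < n) normc z ^+ i).
Proof.
move=> z1 M0 cM; set S := fun k => \sum_(i < k) c i * cis s ^+ i.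
have [w zE] : exists w, z = w * cis s by exists (z / cis s); rewrite divfK// cis_neq0.
have nw : normc w = normc z by rewrite -[LHS]mulr1 -(normc_cis s) -normcM -zE.
have SS k : S k.+1 = S k + c k * cis s ^+ k by rewrite /S big_ord_recr.
have E : \sum_(i < n) c i * z ^+ i =
    S n * w ^+ n + \sum_(i < n) S i.+1 * (w ^+ i * (1 - w)).
  elim: (n) => [|k IH]; first by rewrite /S !big_ord0 mul0r addr0.
  rewrite big_ord_recr /= IH [in RHS]big_ord_recr /= !SS zE exprMn exprS.
  by ring.
rewrite E mulrDr mulr1; apply: le_trans (normcD _ _) _; apply: lerD.
  rewrite normcM normcX nw -[leRHS]mulr1; apply: ler_pM; [exact: normc_ge0| |exact: cM|].
    by rewrite exprn_ge0 ?normc_ge0.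
  by rewrite exprn_ile1 ?normc_ge0.
have -> : normc (cis s - z) = normc (1 - w).
  by rewrite -[RHS]mul1r -(normc_cis s) -normcM mulrBr mulr1 mulrC -zE.
elim: (n) => [|k IH]; first by rewrite !big_ord0 normc0 !mulr0.
rewrite !big_ord_recr /= [X in _ <= M * X]mulrDr [leRHS]mulrDr.
apply: le_trans (normcD _ _) _; apply: lerD => //.
rewrite !normcM normcX nw [leRHS]mulrA [in leRHS]mulrAC -[leRHS]mulrA.
by rewrite ler_wpM2r ?mulr_ge0 ?exprn_ge0 ?normc_ge0// cM.
Qed.

Lemma horner_lip p : exists2 L : R, 0 <= L &
  forall z w, normc z <= 1 -> normc w <= 1 ->
    normc (p.[z] - p.[w]) <= L * normc (z - w).
Proof.
elim/poly_ind: p => [|p c [L L0 pL]].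
  by exists 0 => // z w _ _; rewrite !horner0 subrr normc0 mul0r.
exists (L + normc p.[0] + L); first by rewrite !addr_ge0 ?normc_ge0.
move=> z w z1 w1; rewrite !hornerE.
have -> : p.[z] * z + c - (p.[w] * w + c) = (p.[z] - p.[w]) * z + p.[w] * (z - w) by ring.
apply: le_trans (normcD _ _) _; rewrite !normcM -addrA mulrDl; apply: lerD.
  rewrite -[leRHS]mulr1 ler_pM ?normc_ge0//; exact: pL.
rewrite ler_wpM2r ?normc_ge0// addrC.
have -> : p.[w] = p.[w] - p.[0] + p.[0] by rewrite subrK.
apply: le_trans (normcD _ _) _; rewrite lerD2r.
apply: le_trans (pL _ _ w1 _) _; first by rewrite normc0.
by rewrite subr0 ler_piMr.
Qed.

Lemma horner_bound p : exists2 L : R, 0 <= L &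
  forall z, normc z <= 1 -> normc p.[z] <= L.
Proof.
have [L L0 pL] := horner_lip p; exists (L + normc p.[0]).
  by rewrite addr_ge0 ?normc_ge0.
move=> z z1; rewrite -[p.[z]](subrK p.[0]); apply: le_trans (normcD _ _) _.
rewrite lerD2r; apply: le_trans (pL _ _ z1 _) _; first by rewrite normc0.
by rewrite subr0 ler_piMr.
Qed.

End plane.

(** * The maximum principle *)

Section maxprinc.
Variable R : realType.
Local Notation C := R[i].
Local Notation Re := complex.Re.
Local Notation Im := complex.Im.
Implicit Types (z w : C) (p : {poly C}).

Definition four_sum (u : C -> R) z (h : R) : R :=
  u (z + h%:C) + u (z - h%:C) + u (z + h%:C * 'i%C) + u (z - h%:C * 'i%C).

(* A discrete form of harmonicity: it forces the Laplacian of u to vanish at z. *)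
Definition flat_at (u : C -> R) z :=
  exists2 K : R, 0 <= K & exists2 r : R, 0 < r &
    forall h, 0 < h < r -> `|four_sum u z h - 4 * u z| <= K * h ^+ 3.

Lemma flatD u v z : flat_at u z -> flat_at v z -> flat_at (fun x => u x + v x) z.
Proof.
move=> [K K0 [r r0 ur]] [L L0 [s s0 vs]].
exists (K + L); first exact: addr_ge0.
exists (Num.min r s); first by rewrite lt_min r0 s0.
move=> h; rewrite lt_min => /andP[h0 /andP[hr hs]].
have -> : four_sum (fun x => u x + v x) z h - 4 * (u z + v z) =
  (four_sum u z h - 4 * u z) + (four_sum v z h - 4 * v z) by rewrite /four_sum; ring.
by apply: le_trans (ler_normD _ _) _; rewrite [leRHS]mulrDl; apply: lerD; [apply: ur|apply: vs]; rewrite h0.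
Qed.

Lemma flat_cst a z : flat_at (fun=> a) z.
Proof.
exists 0 => //; exists 1 => // h _; rewrite /four_sum mul0r.
by rewrite (_ : _ - _ = 0) ?normr0//; ring.
Qed.

Lemma flatZ a u z : flat_at u z -> flat_at (fun x => a * u x) z.
Proof.
move=> [K K0 [r r0 ur]]; exists (`|a| * K); first exact: mulr_ge0.
exists r => // h hr.
have -> : four_sum (fun x => a * u x) z h - 4 * (a * u z) =
  a * (four_sum u z h - 4 * u z) by rewrite /four_sum; ring.
by rewrite normrM -mulrA ler_wpM2l ?ur.
Qed.

Lemma flat_sum (I : Type) (s : seq I) (P : pred I) (u : I -> C -> R) z :
  (forall i, P i -> flat_at (u i) z) -> flat_at (fun x => \sum_(i <- s | P i) u i x) z.
Proof.
move=> fu; elim: s => [|i s IH].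
  rewrite (_ : (fun _ => _) = fun=> 0); first exact: flat_cst.
  by apply/funext => x; rewrite big_nil.
have [Pi|Pi] := boolP (P i).
  rewrite (_ : (fun _ => _) = fun x => u i x + \sum_(i <- s | P i) u i x).
    by apply: flatD => //; exact: fu.
  by apply/funext => x; rewrite big_cons Pi.
rewrite (_ : (fun _ => _) = fun x => \sum_(i <- s | P i) u i x)//.
by apply/funext => x; rewrite big_cons (negbTE Pi).
Qed.

(** The Poisson kernel, equal to Re ((b + z) / (b - z)). It is normalised to be 1 at the origin; the
    poles used below lie outside the closed disc, so it is continuous there. *)
Definition poisson (b z : C) : R := (normc b ^+ 2 - normc z ^+ 2) / normc (b - z) ^+ 2.

Lemma poissonE b z : b != z -> poisson b z = Re (2 * b / (b - z)) - 1.
Proof.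
case: b z => [b1 b2] [z1 z2] bz.
have nz : (b1 - z1) ^+ 2 + (b2 - z2) ^+ 2 != 0.
  rewrite paddr_eq0 ?sqr_ge0// !sqrf_eq0 !subr_eq0; apply: contra bz => /andP[/eqP-> /eqP->].
  exact: eqxx.
rewrite /poisson !sqr_normcE; simpc => /=.
by field.
Qed.

(** The left side is the logarithmic derivative in [x] of [x ^+ 4 - h ^+ 4], whose roots are the
    four rotations of [h]. All powers of [h] below the fourth thus cancel. *)
Lemma four_inv (x h : C) : x ^+ 4 != h ^+ 4 ->
  (x - h)^-1 + (x + h)^-1 + (x - h * 'i%C)^-1 + (x + h * 'i%C)^-1 =
  4 * x ^+ 3 / (x ^+ 4 - h ^+ 4).
Proof.
move=> xh; have i2 : 'i%C ^+ 2 = -1 :> C by exact: sqr_i.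
have E : x ^+ 4 - h ^+ 4 = (x - h) * (x + h) * ((x - h * 'i%C) * (x + h * 'i%C)).
  have -> : (x - h * 'i%C) * (x + h * 'i%C) = x ^+ 2 - h ^+ 2 * 'i%C ^+ 2 by ring.
  by rewrite i2; ring.
have : x ^+ 4 - h ^+ 4 != 0 by rewrite subr_eq0.
rewrite E !mulf_eq0 !negb_or => /andP[/andP[h1 h2] /andP[h3 h4]].
have H1 : (x - h)^-1 + (x + h)^-1 = 2 * x / (x ^+ 2 - h ^+ 2).
  have -> : x ^+ 2 - h ^+ 2 = (x - h) * (x + h) by ring.
  by field; rewrite h1 h2.
have H2 : (x - h * 'i%C)^-1 + (x + h * 'i%C)^-1 = 2 * x / (x ^+ 2 + h ^+ 2).
  have -> : x ^+ 2 + h ^+ 2 = (x - h * 'i%C) * (x + h * 'i%C).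
    have -> : (x - h * 'i%C) * (x + h * 'i%C) = x ^+ 2 - h ^+ 2 * 'i%C ^+ 2 by ring.
    by rewrite i2; ring.
  by field; rewrite h3 h4.
have E2 : x ^+ 2 + h ^+ 2 = (x - h * 'i%C) * (x + h * 'i%C).
  have -> : (x - h * 'i%C) * (x + h * 'i%C) = x ^+ 2 - h ^+ 2 * 'i%C ^+ 2 by ring.
  by rewrite i2; ring.
have n2 : x ^+ 2 + h ^+ 2 != 0 by rewrite E2 mulf_neq0.
have n1 : x ^+ 2 - h ^+ 2 != 0.
  have -> : x ^+ 2 - h ^+ 2 = (x - h) * (x + h) by ring.
  by rewrite mulf_neq0.
rewrite -E -[LHS]addrA H1 H2.
have -> : x ^+ 4 - h ^+ 4 = (x ^+ 2 - h ^+ 2) * (x ^+ 2 + h ^+ 2) by ring.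
by field; rewrite n1 n2.
Qed.

Lemma flat_poisson b z : b != z -> flat_at (poisson b) z.
Proof.
move=> bz; set x := b - z; have x0 : x != 0 by rewrite subr_eq0.
have nx : 0 < normc x by rewrite lt_def normc_eq0 x0 normc_ge0.
(* The error is the real part of [8 * b * h ^+ 4 / (x * (x ^+ 4 - h ^+ 4))]. For [h < normc x / 2]
   the denominator has modulus at least [normc x ^+ 5 / 2], and one factor [h < 1] is given away. *)
exists (16 * normc b / normc x ^+ 5).
  by rewrite !mulr_ge0 ?normc_ge0// invr_ge0 exprn_ge0// normc_ge0.
exists (Num.min 1 (normc x / 2)); first by rewrite lt_min ltr01 divr_gt0.
move=> h; rewrite lt_min => /andP[h0 /andP[h1 hx]].
have hh : normc h%:C = h by rewrite normcR gtr0_norm.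
have hi : normc (h%:C * 'i%C) = h.
  by rewrite normcM hh /= expr0n expr1n add0r sqrtr1 mulr1.
have nb (v : C) : normc v = h -> b != z + v.
  move=> vh; apply/eqP => e; move: vh hx; rewrite /x e addrAC subrr add0r => ->; lra.
have nb' (v : C) : normc v = h -> b != z - v.
  by move=> vh; apply: nb; rewrite normcN.
have x4 : normc x ^+ 4 / 2 <= normc (x ^+ 4 - h%:C ^+ 4).
  apply: le_trans (normc_sub _ _); rewrite !normcX hh.
  have : h ^+ 4 <= (normc x / 2) ^+ 4 by rewrite lerXn2r ?nnegrE// ltW// divr_gt0.
  have -> : (normc x / 2) ^+ 4 = normc x ^+ 4 / 16 by field.
  by have : 0 <= normc x ^+ 4 by [rewrite exprn_ge0// ltW]; lra.
have nx4 : 0 < normc (x ^+ 4 - h%:C ^+ 4).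
  by apply: lt_le_trans x4; rewrite divr_gt0// exprn_gt0.
have n4 : x ^+ 4 - h%:C ^+ 4 != 0 by rewrite -normc_eq0 gt_eqF.
have -> : four_sum (poisson b) z h - 4 * poisson b z =
    Re (8 * b * h%:C ^+ 4 / (x * (x ^+ 4 - h%:C ^+ 4))).
  rewrite /four_sum !poissonE ?nb ?nb' ?normcN//.
  have S := @four_inv x h%:C; rewrite -subr_eq0 in S; have {}S := S n4.
  have -> : 8 * b * h%:C ^+ 4 / (x * (x ^+ 4 - h%:C ^+ 4)) =
     2 * b * (4 * x ^+ 3 / (x ^+ 4 - h%:C ^+ 4)) - 4 * (2 * b / x).
    by field; rewrite n4 x0.
  rewrite -S !mulrDr /x.
  have -> : b - (z + h%:C) = b - z - h%:C by ring.
  have -> : b - (z - h%:C) = b - z + h%:C by ring.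
  have -> : b - (z + h%:C * 'i%C) = b - z - h%:C * 'i%C by ring.
  have -> : b - (z - h%:C * 'i%C) = b - z + h%:C * 'i%C by ring.
  have ReD (v w : C) : Re (v + w) = Re v + Re w by case: v w => ? ? [].
  have ReB (v w : C) : Re (v - w) = Re v - Re w by case: v w => ? ? [].
  have Re4 (v : C) : Re (4 * v) = 4 * Re v.
    have -> : 4 * v = v + v + v + v by ring.
    by rewrite !ReD; ring.
  by rewrite ReB Re4 !ReD; ring.
apply: le_trans (Re_le_normc _) _.
rewrite !(normcM, normcV, normcX) hh.
have -> : normc 8 = 8 :> R.
  have -> : 8 = (8 : R)%:C :> C by rewrite rmorph_nat.
  by rewrite normcR ger0_norm.
rewrite ler_pdivrMr ?mulr_gt0//.
have -> : 16 * normc b / normc x ^+ 5 * h ^+ 3 * (normc x * normc (x ^+ 4 - h%:C ^+ 4)) =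
   (8 * normc b * h ^+ 3) * (normc (x ^+ 4 - h%:C ^+ 4) * 2 / normc x ^+ 4).
  by field; rewrite gt_eqF.
rewrite exprSr mulrA ler_wpM2l ?mulr_ge0 ?normc_ge0 ?exprn_ge0 ?(ltW h0)//.
apply: le_trans (ltW h1) _; rewrite ler_pdivlMr ?exprn_gt0// mul1r -ler_pdivrMr//.
Qed.

Definition four_prod p z (h : R) : C :=
  p.[z + h%:C] * p.[z - h%:C] * p.[z + h%:C * 'i%C] * p.[z - h%:C * 'i%C].

Lemma horner_taylor2 p : exists q : {poly C}, exists a b d : C,
  a = p.[0] /\ p = q * 'X^3 + d%:P * 'X^2 + b%:P * 'X + a%:P.
Proof.
have step (r : {poly C}) : exists s, r = s * 'X + (r.[0])%:P.
  elim/poly_ind: r => [|r c _]; first by exists 0; rewrite mul0r horner0 add0r.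
  by exists r; rewrite !hornerE.
have [s1 E1] := step p; have [s2 E2] := step s1; have [s3 E3] := step s2.
exists s3, p.[0], s1.[0], s2.[0]; split=> //.
by rewrite {1}E1 {1}E2 {1}E3 !exprS expr0; ring.
Qed.

(* The product over the four directions is invariant under h -> i h, hence a
   polynomial in h ^+ 4; only the vanishing of its terms h and h ^+ 2 matters. *)
Lemma four_prod_bound p z : exists2 K : R, 0 <= K &
  forall h, 0 < h < 1 -> normc p.[z] ^+ 4 - K * h ^+ 3 <= normc (four_prod p z h).
Proof.
set g := p \Po ('X + z%:P); set j : C := 'i%C.
have j2 : j * j = -1 by rewrite -expr2 /j sqr_i.
have gE x : g.[x] = p.[z + x] by rewrite horner_comp !hornerE addrC.
have [q [a [b [d [aE E]]]]] := horner_taylor2 g.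
have aE' : a = p.[z] by rewrite aE gE addr0.
have gu x : g.[x] = q.[x] * x ^+ 3 + d * x ^+ 2 + b * x + a by rewrite {1}E !hornerE.
(* With [g] the recentred polynomial, [G s] is [g] at [s * x], split into its quadratic Taylor part
   [U] and a remainder [Q s] times the cube of the variable. *)
pose U (s t : C) : {poly C} := s%:P * 'X^2 + t%:P * 'X + a%:P.
pose Q (s : C) : {poly C} := (s ^+ 3)%:P * (q \Po (s%:P * 'X)).
pose G (s : C) : {poly C} := U (s ^+ 2 * d) (s * b) + Q s * 'X^3.
have GE s x : (G s).[x] = g.[s * x].
  rewrite gu /G /U /Q !(hornerD, hornerM, hornerC, hornerX, hornerXn) horner_comp !(hornerM, hornerC, hornerX).
  by ring.
(* The first four summands replace the factors one at a time by their quadratic parts. The last one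
   comes from the product of the four quadratics, which is [a ^+ 4] plus a multiple of [x ^+ 4]. *)
pose V : {poly C} := Q 1 * G (-1) * G j * G (- j) + U d b * Q (-1) * G j * G (- j) +
  U d b * U d (- b) * Q j * G (- j) + U d b * U d (- b) * U (- d) (j * b) * Q (- j) +
  'X * ((d ^+ 4)%:P * 'X^4 + (2 * a ^+ 2 * d ^+ 2 - (2 * a * d - b ^+ 2) ^+ 2)%:P).
have VE x : g.[x] * g.[- x] * g.[j * x] * g.[- j * x] = a ^+ 4 + V.[x] * x ^+ 3.
  have U34 : (- d * x ^+ 2 + j * b * x + a) * (- d * x ^+ 2 - j * b * x + a) =
      (a - d * x ^+ 2) ^+ 2 + b ^+ 2 * x ^+ 2.
    transitivity ((a - d * x ^+ 2) ^+ 2 - (j * j) * (b ^+ 2 * x ^+ 2)); first by ring.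
    by rewrite j2; ring.
  have e1 : g.[x] = (U d b).[x] + (Q 1).[x] * x ^+ 3.
    by rewrite -[in LHS](mul1r x) -GE /G expr1n !mul1r hornerD hornerM hornerXn.
  have e2 : g.[-1 * x] = (U d (- b)).[x] + (Q (-1)).[x] * x ^+ 3.
    by rewrite -GE /G sqrrN expr1n mul1r mulN1r hornerD hornerM hornerXn.
  have e3 : g.[j * x] = (U (- d) (j * b)).[x] + (Q j).[x] * x ^+ 3.
    by rewrite -GE /G expr2 j2 mulN1r hornerD hornerM hornerXn.
  have e4 : g.[- j * x] = (U (- d) (- j * b)).[x] + (Q (- j)).[x] * x ^+ 3.
    by rewrite -GE /G sqrrN expr2 j2 mulN1r hornerD hornerM hornerXn.
  have V0 : V.[x] = (Q 1).[x] * g.[-1 * x] * g.[j * x] * g.[- j * x] +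
    (U d b).[x] * (Q (-1)).[x] * g.[j * x] * g.[- j * x] +
    (U d b).[x] * (U d (- b)).[x] * (Q j).[x] * g.[- j * x] +
    (U d b).[x] * (U d (- b)).[x] * (U (- d) (j * b)).[x] * (Q (- j)).[x] +
    x * (d ^+ 4 * x ^+ 4 + (2 * a ^+ 2 * d ^+ 2 - (2 * a * d - b ^+ 2) ^+ 2)).
    by rewrite -!GE /V !(hornerD, hornerM, hornerC, hornerX, hornerXn).
  rewrite -(mulN1r x) V0 {}e1 {}e2 {}e3 {}e4.
  move: (Q 1).[x] (Q (-1)).[x] (Q j).[x] (Q (- j)).[x] => q1 q2 q3 q4.
  have U12 : (U d b).[x] * (U d (- b)).[x] * ((U (- d) (j * b)).[x] * (U (- d) (- j * b)).[x]) =
      a ^+ 4 + x ^+ 4 * (d ^+ 4 * x ^+ 4 + (2 * a ^+ 2 * d ^+ 2 - (2 * a * d - b ^+ 2) ^+ 2)).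
    have Ux s t : (U s t).[x] = s * x ^+ 2 + t * x + a.
      by rewrite /U !(hornerD, hornerM, hornerC, hornerX, hornerXn).
    rewrite !Ux; transitivity ((d * x ^+ 2 + b * x + a) * (d * x ^+ 2 - b * x + a) *
      ((- d * x ^+ 2 + j * b * x + a) * (- d * x ^+ 2 - j * b * x + a))); first by ring.
    by rewrite U34; ring.
  move: U12.
  move: (U d b).[x] (U d (- b)).[x] (U (- d) (j * b)).[x] (U (- d) (- j * b)).[x] => u1 u2 u3 u4 U12.
  transitivity (u1 * u2 * (u3 * u4) + (q1 * (u2 + q2 * x ^+ 3) * (u3 + q3 * x ^+ 3) * (u4 + q4 * x ^+ 3)
    + u1 * q2 * (u3 + q3 * x ^+ 3) * (u4 + q4 * x ^+ 3) + u1 * u2 * q3 * (u4 + q4 * x ^+ 3)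
    + u1 * u2 * u3 * q4) * x ^+ 3); first by ring.
  by rewrite U12; ring.
have [K K0 VK] := horner_bound V; exists K => // h /andP[h0 h1].
have hh : normc h%:C = h by rewrite normcR gtr0_norm.
have -> : four_prod p z h = a ^+ 4 + V.[h%:C] * h%:C ^+ 3.
  by rewrite -VE !gE /four_prod mulNr (mulrC j).
set W := V.[h%:C] * h%:C ^+ 3.
have : normc W <= K * h ^+ 3.
  by rewrite normcM normcX hh ler_wpM2r ?exprn_ge0 ?(ltW h0)// VK// hh ltW.
have := normcD (a ^+ 4 + W) (- W); rewrite addrK normcN normcX aE'; lra.
Qed.

(* The factor expR (normc z ^+ 2) makes the logarithm strictly subharmonic. *)
Definition wmod p (u : C -> R) z : R := normc p.[z] * expR (u z + normc z ^+ 2).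

(** The values at the four points at distance [h] are multiplied. The terms [normc w ^+ 2] gain
    exactly [4 * h ^+ 2] in the exponent, while the polynomial and [u] lose only O(h^3), so for
    small [h] the product exceeds the fourth power of the value at [z]. *)
Lemma no_interior_max p u z r : 0 < r -> p.[z] != 0 -> flat_at u z ->
  ~ (forall w, normc (w - z) < r -> wmod p u w <= wmod p u z).
Proof.
move=> r0 pz [K2 K20 [r2 r20 uK]] max.
have [K1 K10 pK] := four_prod_bound p z.
set a := normc p.[z] ^+ 4 in pK.
have a0 : 0 < a by rewrite exprn_gt0// lt_def normc_ge0 normc_eq0 pz.
(* [K2 * h <= 1] leaves [3 * h ^+ 2] of the gain, [K1 * h <= a] limits the loss of the polynomial to
   [a * h ^+ 2], and [h <= 1 / 2] makes (1 - h^2)(1 + 3h^2) exceed 1. *)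
have [h [h0 h1 hr hr2 [hK2 hK1]]] : exists h, [/\ 0 < h, h <= 1 / 2, h < r, h < r2 &
    K2 * h <= 1 /\ K1 * h <= a].
  pose m := Num.min (Num.min 1 r) (Num.min r2 (Num.min (K2 + 1)^-1 (a / (K1 + 1)))).
  have m0 : 0 < m by rewrite !lt_min ltr01 r0 r20 invr_gt0 divr_gt0//= ltr_wpDl.
  have [m1 m2 m3 m4 m5] : [/\ m <= 1, m <= r, m <= r2, m <= (K2 + 1)^-1 & m <= a / (K1 + 1)].
    by split; rewrite !ge_min lexx ?orbT.
  exists (m / 2); split; [lra|lra|lra|lra|split].
    have : (K2 + 1) * m <= 1 by rewrite mulrC -ler_pdivlMr ?ltr_wpDl// mul1r.
    rewrite mulrDl mul1r; have : 0 <= K2 * m by rewrite mulr_ge0// ltW.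
    by lra.
  have : (K1 + 1) * m <= a by rewrite mulrC -ler_pdivlMr ?ltr_wpDl.
  rewrite mulrDl mul1r; have : 0 <= K1 * m by rewrite mulr_ge0// ltW.
  by lra.
have hh : normc h%:C = h by rewrite normcR gtr0_norm.
have hi : normc (h%:C * 'i%C) = h.
  by rewrite normcM hh /= expr0n expr1n add0r sqrtr1 mulr1.
have max' v : normc v = h -> wmod p u (z + v) <= wmod p u z.
  by move=> vh; apply: max; rewrite addrC addKr vh.
have E : wmod p u (z + h%:C) * wmod p u (z - h%:C) * wmod p u (z + h%:C * 'i%C) *
    wmod p u (z - h%:C * 'i%C) <= wmod p u z ^+ 4.
  have wm_ge0 w : 0 <= wmod p u w by rewrite mulr_ge0 ?normc_ge0 ?expR_ge0.
  have m1 := max' _ hh; have m3 := max' _ hi.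
  have m2 : wmod p u (z - h%:C) <= wmod p u z by apply: max'; rewrite normcN.
  have m4 : wmod p u (z - h%:C * 'i%C) <= wmod p u z by apply: max'; rewrite normcN.
  have prod4 (a1 a2 a3 a4 e : R) : 0 <= a1 -> 0 <= a2 -> 0 <= a3 -> 0 <= a4 ->
      a1 <= e -> a2 <= e -> a3 <= e -> a4 <= e -> a1 * a2 * a3 * a4 <= e ^+ 4.
    move=> *; rewrite !exprS expr0 mulr1 !mulrA.
    by do 3![apply: ler_pM; rewrite ?mulr_ge0//].
  exact: prod4.
have S2 : normc (z + h%:C) ^+ 2 + normc (z - h%:C) ^+ 2 + normc (z + h%:C * 'i%C) ^+ 2 +
    normc (z - h%:C * 'i%C) ^+ 2 = 4 * normc z ^+ 2 + 4 * h ^+ 2.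
  by rewrite !sqr_normcE; case: (z) => x y; simpc => /=; ring.
have L : wmod p u (z + h%:C) * wmod p u (z - h%:C) * wmod p u (z + h%:C * 'i%C) *
    wmod p u (z - h%:C * 'i%C) = normc (four_prod p z h) *
    expR (four_sum u z h + (4 * normc z ^+ 2 + 4 * h ^+ 2)).
  rewrite -S2 /wmod /four_prod /four_sum !normcM.
  set n1 := normc p.[_]; set n2 := normc p.[_]; set n3 := normc p.[_]; set n4 := normc p.[_].
  set a1 := u _; set a2 := u _; set a3 := u _; set a4 := u _.
  set b1 := normc _ ^+ 2; set b2 := normc _ ^+ 2; set b3 := normc _ ^+ 2; set b4 := normc _ ^+ 2.
  have -> : a1 + a2 + a3 + a4 + (b1 + b2 + b3 + b4) =
    (a1 + b1) + (a2 + b2) + (a3 + b3) + (a4 + b4) by ring.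
  by rewrite !(expRD _ (_ + _)); ring.
have Rr : wmod p u z ^+ 4 = a * expR (4 * u z + 4 * normc z ^+ 2).
  rewrite /wmod exprMn -/a -expRM_natl; congr (_ * expR _); ring.
move: E; rewrite L Rr => E.
set y := four_sum u z h + (4 * normc z ^+ 2 + 4 * h ^+ 2) - (4 * u z + 4 * normc z ^+ 2).
have {}E : normc (four_prod p z h) * expR y <= a.
  by rewrite /y expRD expRN mulrA ler_pdivrMr ?expR_gt0.
have y3 : 1 + 3 * h ^+ 2 <= expR y.
  apply: le_trans (expR_ge1Dx _); rewrite lerD2l /y.
  have := uK h; rewrite h0 hr2 => /(_ isT); rewrite ler_norml => /andP[+ _].
  have : K2 * h ^+ 3 <= h ^+ 2.
    by rewrite exprSr mulrCA ler_piMr ?exprn_ge0// ltW.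
  by lra.
have := pK h; rewrite h0 (le_lt_trans h1) => [/(_ isT) fp|]; last by lra.
have k1 : K1 * h ^+ 3 <= a * h ^+ 2.
  by rewrite exprSr mulrCA [leRHS]mulrC ler_wpM2l ?exprn_ge0// ltW.
have h2 : 0 < h ^+ 2 <= 1 / 4.
  rewrite exprn_gt0//= expr2; have : h * h <= (1 / 2) * (1 / 2) by rewrite ler_pM// ltW.
  by lra.
have : (a - a * h ^+ 2) * (1 + 3 * h ^+ 2) <= a.
  apply: le_trans E; apply: ler_pM; [| |lra|exact: y3].
    by rewrite -[X in X - _]mulr1 -mulrBr mulr_ge0 ?(ltW a0)//; lra.
  by lra.
have -> : (a - a * h ^+ 2) * (1 + 3 * h ^+ 2) = a + a * (h ^+ 2 * (2 - 3 * h ^+ 2)) by ring.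
rewrite gerDl leNgt mulr_gt0// mulr_gt0//; lra.
Qed.

Lemma nbhs_normcP z (A : set C) :
  nbhs z A <-> exists2 r : R, 0 < r & forall w, normc (w - z) < r -> A w.
Proof.
split.
  move/nbhs_ballP => [[e e'] /= e0 zA].
  move: e0; rewrite ltcE /= => /andP[/eqP e'0 e0]; exists e => // w wz; apply: zA.
  by rewrite -ball_normE /ball_ /= Defs.normcE e'0 ltcR normc_subC.
case=> r r0 rA; apply/nbhs_ballP; exists r%:C; first by rewrite /= ltcR.
by move=> w; rewrite -ball_normE /ball_ /= Defs.normcE ltcR normc_subC => /rA.
Qed.

Lemma horner_cplx_continuous p : continuous (fun z : C => p.[z]).
Proof.
elim/poly_ind: p => [|p c IH].
  by rewrite (_ : (fun _ => _) = fun=> 0); [exact: cst_continuous|apply/funext => x; rewrite horner0].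
rewrite (_ : (fun _ => _) = fun x => p.[x] * x + c); last by apply/funext => x; rewrite !hornerE.
move=> z; apply: (@cvgD _ _ _ (nbhs z) (nbhs_filter z)); last exact: cst_continuous.
by apply: (@cvgM _ _ (nbhs z) (nbhs_filter z)); [exact: IH|exact: cvg_id].
Qed.

Lemma continuous_complex : continuous (fun x : R * R => x.1 +i* x.2 : C).
Proof.
move=> [x y] A /nbhs_normcP[r r0 rA].
exists (ball x (r / 2), ball y (r / 2)) => /=.
  by split; apply: nbhsx_ballx; rewrite divr_gt0.
move=> [x' y'] /= [+ +]; rewrite -!ball_normE /ball_ /= => xx yy; apply: rA.
apply: le_lt_trans (normc_le_ReIm _) _ => /=; rewrite distrC [`|y' - y|]distrC.
by rewrite [r](splitr r) ltrD.
Qed.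

Lemma closed_disc_compact (D : set C) : closed D -> D `<=` [set z | normc z <= 1] ->
  compact D.
Proof.
move=> cD D1.
pose K := (fun x : R * R => x.1 +i* x.2 : C) @` (`[-1, 1]%classic `*` `[-1, 1]%classic).
apply: (@subclosed_compact _ D K) => //.
  apply: continuous_compact; last by apply: compact_setX; exact: segment_compact.
  exact/continuous_subspaceT/continuous_complex.
move=> z /D1 /= z1; exists (Re z, Im z); last by case: (z).
split => /=; rewrite in_itv /= -ler_norml; first exact: le_trans (Re_le_normc _) z1.
rewrite (le_trans _ z1)// -ler_sqr ?nnegrE ?normc_ge0// sqr_normcE.
by rewrite real_normK ?num_real// lerDr sqr_ge0.
Qed.

(** The maximum of [wmod p u] is taken over the part of the disc where [u] is nonnegative. It lies
    on the level set [u = 0], on the unit circle, or inside, where [no_interior_max] leaves only a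
    zero of [p]. The factor [expR 1] pays for [expR (normc z ^+ 2)]. *)
Lemma max_principle p u (B : R) : 0 <= B ->
  (forall z, normc z <= 1 -> {for z, continuous u}) ->
  (forall z, normc z < 1 -> flat_at u z) ->
  (forall z, normc z <= 1 -> u z = 0 -> normc p.[z] <= B) ->
  (forall z, normc z = 1 -> 0 < u z -> normc p.[z] * expR (u z) <= B) ->
  0 <= u 0 -> normc p.[0] * expR (u 0) <= B * expR 1.
Proof.
move=> B0 uc uf pB1 pB2 u0.
pose D : set C := [set z | normc z <= 1 /\ 0 <= u z].
have cD : closed D.
  move=> z Dz.
  (* The limit point is placed in the disc first, because [u] is known to be continuous only
     there. *)
  have z1 : normc z <= 1.
    rewrite leNgt; apply/negP => z1.
    have [w [[w1 _] /= zw]] := Dz [set w | 1 < normc w] (normc_continuous (lt_nbhsr z1)).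
    by rewrite ltNge w1 in zw.
  split=> //; rewrite leNgt; apply/negP => uz.
  have [w [[_ w1] /= zw]] := Dz [set w | u w < 0] (uc _ z1 _ (lt_nbhsl uz)).
  by rewrite ltNge w1 in zw.
have D0 : D 0 by split; rewrite ?normc0.
have wm_continuous z : normc z <= 1 -> {for z, continuous (wmod p u)}.
  move=> z1; apply: (@cvgM _ _ (nbhs z) (nbhs_filter z)).
    apply: (@continuous_comp _ _ _ (fun z : C => p.[z]) (@normc R)).
      exact: horner_cplx_continuous.
    exact: normc_continuous.
  apply: (@continuous_comp _ _ _ (fun z : C => u z + normc z ^+ 2) (@expR R)); last first.
    exact: continuous_expR.
  apply: (@cvgD _ _ _ (nbhs z) (nbhs_filter z)); first exact: uc.
  by apply: (@cvgM _ _ (nbhs z) (nbhs_filter z)); exact: normc_continuous.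
have [|||c /set_mem Dc cmax] := @compact_EVT_max _ R (wmod p u) D _ (closed_disc_compact cD _).
- by exists 0.
- by move=> z [].
- by apply: continuous_in_subspaceT => z /set_mem[z1 _]; exact: wm_continuous.
suff H : wmod p u c <= B * expR 1.
  apply: le_trans H; have := cmax 0 (mem_set D0).
  by rewrite {1}/wmod normc0 expr0n addr0.
have [c1 uc0] := Dc.
have wm_le : normc p.[c] * expR (u c) <= B -> wmod p u c <= B * expR 1.
  move=> H; rewrite /wmod expRD mulrA ler_pM ?mulr_ge0 ?normc_ge0 ?expR_ge0//.
  by rewrite ler_expR exprn_ile1 ?normc_ge0.
move: uc0; rewrite le_eqVlt => /predU1P[uc0|uc0].
  by apply: wm_le; rewrite -uc0 expR0 mulr1 pB1.
move: c1; rewrite le_eqVlt => /predU1P[c1|c1]; first by apply: wm_le; exact: pB2.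
have [pc|pc] := eqVneq p.[c] 0.
  by rewrite /wmod pc normc0 mul0r mulr_ge0 ?expR_ge0.
have : nbhs c D.
  have n1 : nbhs c [set w | normc w < 1] := normc_continuous (lt_nbhsl c1).
  have n2 : nbhs c [set w | 0 < u w] := uc _ (ltW c1) _ (lt_nbhsr uc0).
  by apply: filterS (filterI n1 n2) => w [/ltW ? /ltW].
case/nbhs_normcP => r r0 rD; exfalso; apply: (no_interior_max r0 pc (uf _ c1)).
by move=> w /rD Dw; apply: cmax; exact: mem_set.
Qed.

End maxprinc.

(** * The harmonic barrier *)

Section barrier.
Variable R : realType.
Local Notation C := R[i].
Implicit Types (z w : C) (p : {poly C}).

Lemma poisson_continuous (b z : C) : b != z -> {for z, continuous (poisson b)}.
Proof.
move=> bz; apply: (@cvgM _ _ (nbhs z) (nbhs_filter z)).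
  apply: (@cvgB _ _ _ (nbhs z) (nbhs_filter z)); first exact: cst_continuous.
  by apply: (@cvgM _ _ (nbhs z) (nbhs_filter z)); exact: normc_continuous.
apply: (@cvgV _ _ (nbhs z) (nbhs_filter z)).
  by rewrite expf_neq0// normc_eq0 subr_eq0.
have H : {for z, continuous (fun x : C => normc (b - x))}.
  apply: (@continuous_comp _ _ _ (fun x : C => b - x) (@normc R)); last exact: normc_continuous.
  by apply: (@cvgB _ _ _ (nbhs z) (nbhs_filter z)); [exact: cst_continuous|exact: cvg_id].
by apply: (@cvgM _ _ (nbhs z) (nbhs_filter z)); exact: H.
Qed.

Variable n : nat.
Local Notation K := (n.+1%:R : R).

Definition theta : R := 2 * pi / K.
Definition rho : R := 1 + K^-1.
(** The pole lies above the left end of the arc [j], at distance 1/K from the circle, which is the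
    order of the arc length. *)
Definition pole (j : nat) : C := rho%:C * cis (theta * j%:R).
(** A discrete harmonic measure of the bad arcs: at the origin it is their proportion ([barrier0]),
    and it is bounded below near any long enough run of them. *)
Definition barrier (bad : pred 'I_n.+1) (z : C) : R :=
  K^-1 * \sum_(j | bad j) poisson (pole j) z.

Let K0 : 0 < K. Proof. by rewrite ltr0n. Qed.
Let Ki0 : 0 < K^-1. Proof. by rewrite invr_gt0. Qed.
Let theta0 : 0 < theta. Proof. by rewrite divr_gt0// mulr_gt0// pi_gt0. Qed.
Let rho0 : 1 < rho. Proof. by rewrite /rho ltrDl. Qed.

Lemma theta_le : theta <= 8 * K^-1.
Proof.
rewrite /theta ler_pM2r//; have := pihalf_lt2 R; lra.
Qed.

Lemma normc_pole j : normc (pole j) = rho.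
Proof. by rewrite normcM normc_cis mulr1 normcR gtr0_norm// (lt_trans _ rho0). Qed.

Lemma pole_neq j z : normc z <= 1 -> pole j != z.
Proof.
by move=> z1; apply: contraTneq z1 => <-; rewrite normc_pole -ltNge.
Qed.

Variable bad : pred 'I_n.+1.

Lemma barrier_continuous z : normc z <= 1 -> {for z, continuous (barrier bad)}.
Proof.
move=> z1; apply: (@cvgM _ _ (nbhs z) (nbhs_filter z)); first exact: cst_continuous.
elim: (index_enum _) => [|j l IH].
  under eq_fun do rewrite big_nil.
  by rewrite big_nil; exact: cst_continuous.
under eq_fun do rewrite big_cons.
rewrite big_cons; case: (bad j) => //.
apply: (@cvgD _ _ _ (nbhs z) (nbhs_filter z)) => //.
by apply: poisson_continuous; exact: pole_neq.
Qed.

Lemma barrier_flat z : normc z <= 1 -> flat_at (barrier bad) z.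
Proof.
move=> z1; apply: flatZ; apply: flat_sum => j _; apply: flat_poisson.
exact: pole_neq.
Qed.

Lemma poisson_ge0 j z : normc z <= 1 -> 0 <= poisson (pole j) z.
Proof.
move=> z1; rewrite divr_ge0 ?exprn_ge0 ?normc_ge0// subr_ge0 normc_pole.
by rewrite lerXn2r ?nnegrE ?normc_ge0 ?(le_trans z1) ?(ltW rho0)// (le_trans _ (ltW rho0)).
Qed.

Lemma barrier_ge0 z : normc z <= 1 -> 0 <= barrier bad z.
Proof.
by move=> z1; rewrite mulr_ge0 ?(ltW Ki0)// sumr_ge0// => j _; exact: poisson_ge0.
Qed.

Lemma barrier0 : barrier bad 0 = #|bad|%:R / K.
Proof.
rewrite /barrier mulrC; congr (_ * _); rewrite (eq_bigr (fun=> 1)).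
  by rewrite sumr_const -mulr_natl mulr1.
move=> j _; rewrite /poisson subr0 normc0 expr0n subr0 divff// expf_neq0//.
by rewrite normc_pole gt_eqF// (lt_trans _ rho0).
Qed.

(** A block of [m] consecutive arcs starts at the arc [j0] containing [t]. It goes upwards if there
    is room and downwards otherwise, so that angles are compared as reals and never wrap around; one
    direction always has room because [m.*2 <= n.+1]. *)
Lemma near_arc (t d : R) : (5 <= n)%N -> 0 <= t < 2 * pi -> K^-1 <= d <= rho ->
  exists2 S : {set 'I_n.+1}, d * K / 4 <= #|S|%:R &
    forall j, j \in S -> `|theta * j%:R - t| <= 10 * d.
Proof.
move=> n5 /andP[t0 t1] /andP[d0 d1].
have d00 : 0 < d := lt_le_trans Ki0 d0.
have KK : K^-1 * K = 1 by rewrite mulVf// gt_eqF.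
pose m := (Num.truncn (d * K / 4)).+1.
have /andP[m1 m2] : (Num.truncn (d * K / 4))%:R <= d * K / 4 < m%:R.
  by apply: truncn_itv; rewrite divr_ge0// mulr_ge0// ltW.
have mE : m%:R = (Num.truncn (d * K / 4))%:R + 1 :> R by rewrite /m -natr1.
have dK : d * K <= K + 1.
  by apply: le_trans (ler_wpM2r (ltW K0) d1) _; rewrite /rho mulrDl mul1r KK.
have mK : (m.*2 <= n.+1)%N.
  rewrite -(ler_nat R) -muln2 natrM mE.
  have : 6 <= K by rewrite ler_nat.
  by move=> ?; lra.
pose j0 := Num.truncn (t / theta).
have /andP[j1 j2] : j0%:R <= t / theta < j0.+1%:R.
  by apply: truncn_itv; rewrite divr_ge0// ltW.
rewrite ler_pdivlMr// in j1; rewrite ltr_pdivrMr// in j2.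
have j0K : (j0 < n.+1)%N.
  rewrite -(ltr_nat R) -(ltr_pM2r theta0); apply: le_lt_trans j1 _.
  by rewrite /theta mulrCA divff ?mulr1// gt_eqF.
(* The [d * K / 4] arcs span at most [2 * d], and rounding up costs one more arc, at most [8 * d] as
   [K^-1 <= d]. *)
have thm : theta * m%:R <= 10 * d.
  rewrite mE.
  have h1 : theta * (Num.truncn (d * K / 4))%:R <= 8 * K^-1 * (d * K / 4).
    by apply: ler_pM => //; [exact: ltW|exact: theta_le].
  have h2 : 8 * K^-1 * (d * K / 4) = 2 * d * (K^-1 * K) by field.
  have := theta_le; rewrite mulrDr mulr1; rewrite KK mulr1 in h2; rewrite h2 in h1.
  by move: (K^-1) d0 h1 => e; move: (theta * _) => x; lra.
have build (e : nat -> nat) : (forall i, (i < m)%N -> (e i < n.+1)%N) ->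
    (forall i k, (i < m)%N -> (k < m)%N -> e i = e k -> i = k) ->
    (forall i, (i < m)%N -> `|theta * (e i)%:R - t| <= theta * m%:R) ->
    exists2 S : {set 'I_n.+1}, d * K / 4 <= #|S|%:R &
    forall j, j \in S -> `|theta * j%:R - t| <= 10 * d.
  move=> eK ei et; pose f (i : 'I_m) : 'I_n.+1 := inord (e i).
  exists [set f i | i : 'I_m].
    rewrite card_imset ?card_ord ?ltW// => i k /(congr1 val).
    by rewrite /= !inordK ?eK// => /ei ik; apply: val_inj; exact: ik.
  move=> _ /imsetP[i _ ->]; rewrite /f inordK ?eK//; apply: le_trans thm; exact: et.
have [jK|jK] := leqP (j0 + m) n.+1.
  apply: (build (fun i => j0 + i)%N) => [i im|i k _ _ /addnI//|i im].
    by apply: leq_trans jK; rewrite ltn_add2l.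
  rewrite natrD mulrDr ler_norml.
  have : theta * i.+1%:R <= theta * m%:R by rewrite ler_pM2l// ler_nat.
  have : 0 <= theta * i%:R by rewrite mulr_ge0// ltW.
  move: j1 j2; rewrite -!natr1 !mulrDr !mulrDl !mul1r !mulr1 (mulrC _ theta).
  by move=> *; apply/andP; split; lra.
have mj : (m <= j0)%N.
  rewrite -(leq_add2r m) addnn; apply: leq_trans mK _; exact: ltnW.
apply: (build (fun i => j0 - i)%N) => [i im|i k im km|i im].
- by apply: leq_ltn_trans j0K; exact: leq_subr.
- have ij := leq_trans (ltnW im) mj; have kj := leq_trans (ltnW km) mj.
  by move=> e; rewrite -(subKn ij) e subKn.
have ij := leq_trans (ltnW im) mj.
rewrite natrB// mulrBr ler_norml.
have : theta * i.+1%:R <= theta * m%:R by rewrite ler_pM2l// ler_nat.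
have : 0 <= theta * i%:R by rewrite mulr_ge0// ltW.
move: j1 j2; rewrite -!natr1 !mulrDr !mulrDl !mul1r !mulr1 (mulrC _ theta).
by move=> *; apply/andP; split; lra.
Qed.

(* The constant 21 is kept abstract because closed numerals unfold in unary. *)
Lemma barrier_near (c : R) z : c = 21 ->
  (5 <= n)%N -> normc z <= 1 -> barrier bad z <= (5 * c ^+ 2)^-1 ->
  exists2 j : 'I_n.+1, ~~ bad j & forall s, theta * j%:R <= s < theta * j.+1%:R ->
    normc (cis s - z) <= 40 * (K^-1 + (1 - normc z)).
Proof.
move=> cE n5 z1 qz; have [t t02 zE] := polar z.
set r := normc z in z1 zE *; set d := K^-1 + (1 - r).
have r0 : 0 <= r := normc_ge0 z.
have dK : K^-1 <= d <= rho by rewrite /d /rho; move: (K^-1) => e; apply/andP; split; lra.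
have d0 : 0 < d by case/andP: dK => /(lt_le_trans Ki0).
have c0 : 0 < c by rewrite cE.
have ctz' : normc (cis t - z) <= 1 - r.
  have -> : cis t - z = (1 - r)%:C * cis t by rewrite zE rmorphB rmorph1 mulrBl mul1r.
  by rewrite normcM normc_cis mulr1 normcR ger0_norm ?subr_ge0.
have ctz : normc (cis t - z) <= d by apply: le_trans ctz' _; rewrite /d lerDr ltW.
have [S cS Sd] := near_arc n5 t02 dK.
(* If all arcs of [S] were bad, at least [d * K / 4] kernels, each at least [(c ^+ 2 * d)^-1], would
   give the barrier at least [(4 * c ^+ 2)^-1], above the threshold [(5 * c ^+ 2)^-1]. *)
have [j jS nbj] : exists2 j, j \in S & ~~ bad j.
  apply: contrapT => H.
  have Sbad j : j \in S -> bad j.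
    by move=> jS; apply/negPn/negP => b; apply: H; exists j.
  have : (5 * c ^+ 2)^-1 < barrier bad z.
    rewrite /barrier [ltRHS]mulrC ltr_pdivlMr//.
    apply: (@lt_le_trans _ _ (\sum_(j in S) poisson (pole j) z)); last first.
      rewrite [leRHS](bigID (mem S)) /= -[leLHS]addr0; apply: lerD.
        rewrite le_eqVlt; apply/orP; left; apply/eqP/eq_bigl => j.
        by case: (boolP (j \in S)) => [/Sbad ->|]; rewrite ?andbF.
      by apply: sumr_ge0 => j _; exact: poisson_ge0.
    have cd0 : 0 < c ^+ 2 * d by rewrite mulr_gt0// exprn_gt0.
    apply: (@lt_le_trans _ _ (\sum_(j in S) (c ^+ 2 * d)^-1)).
      rewrite sumr_const -[ltRHS]mulr_natl.
      apply: (@lt_le_trans _ _ (d * K / 4 * (c ^+ 2 * d)^-1)).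
        have -> : d * K / 4 * (c ^+ 2 * d)^-1 = (4 * c ^+ 2)^-1 * K.
          by field; rewrite !gt_eqF.
        rewrite ltr_pM2r// ltf_pV2 ?posrE ?mulr_gt0 ?exprn_gt0//.
        by rewrite ltr_pM2r ?exprn_gt0// ltr_nat.
      by apply: ler_wpM2r cS; rewrite invr_ge0 ltW.
    apply: ler_sum => j jS; rewrite /poisson normc_pole.
    (* The path goes from the pole to the circle (1/K), along the circle to [cis t] (at most
       [20 * d]), and down to [z] ([1 - r]). The two ends add up to [d], whence 21. *)
    have pz : normc (pole j - z) <= c * d.
      apply: le_trans (normc_dist _ (cis (theta * j%:R)) _) _.
      have -> : pole j - cis (theta * j%:R) = (K^-1)%:C * cis (theta * j%:R).
        by rewrite /pole /rho rmorphD rmorph1 mulrDl mul1r addrAC subrr add0r.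
      rewrite normcM normc_cis mulr1 normcR gtr0_norm//.
      have := normc_dist (cis (theta * j%:R)) (cis t) z.
      have := cis_lip (theta * j%:R) t; have := Sd _ jS; move: ctz'.
      rewrite /d cE; move: (K^-1) => e.
      by move: (normc _) (normc _) (normc _) (`|_|) => ? ? ? ?; lra.
    have pz0 : 0 < normc (pole j - z).
      by rewrite lt_def normc_ge0 normc_eq0 subr_eq0 pole_neq.
    rewrite ler_pdivlMr ?exprn_gt0// ler_pdivrMl//.
    apply: (@le_trans _ _ ((c * d) ^+ 2)).
      by rewrite lerXn2r ?nnegrE ?normc_ge0// mulr_ge0// ltW.
    have -> : rho ^+ 2 - normc z ^+ 2 = d * (rho + r) by rewrite /d /rho -/r; ring.
    have -> : (c * d) ^+ 2 = c ^+ 2 * d * (d * 1) by ring.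
    apply: ler_wpM2l; first exact: ltW.
    apply: ler_wpM2l; first exact: ltW.
    by rewrite (le_trans (ltW rho0))// lerDl.
  by rewrite ltNge qz.
exists j => // s /andP[s1 s2].
apply: le_trans (normc_dist _ (cis t) _) _.
(* Here 18 is 10 plus the 8 of one arc length. Doubled by [cis_lip] and increased by the distance
   from [cis t] to [z], it gives 37, rounded up to 40. *)
have st : `|s - t| <= 18 * d.
  have := Sd _ jS; rewrite !ler_norml => /andP[h1 h2].
  have := theta_le; have : K^-1 <= d by case/andP: dK.
  move: s2; rewrite -natr1 mulrDr mulr1; move: (K^-1) theta h1 h2 s1 => e th ? ? ? ? ? ?.
  by apply/andP; split; lra.
by have := cis_lip s t; lra.
Qed.

End barrier.

(** * The gap estimate for analytic sums *)

(** The order of the quantifiers matters: [kappa] is absolute, and [delta] depends on [M] and [e]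
    but not on the series, on [N] or on [A]. The condition on arcs is asked at every scale because
    [n] is chosen after [N] and the Lipschitz constant of [G]. *)
Lemma analytic_gap (R : realType) : exists2 kappa : R, 0 < kappa &
  forall (M e : R), 0 <= M -> 0 < e -> exists2 delta : R, 0 < delta &
  forall (c : nat -> R[i]) (N : nat) (A : set R),
    (forall n, exists2 bad : pred 'I_n.+1, #|bad|%:R <= kappa * n.+1%:R :> R &
      forall j, ~~ bad j -> exists2 s, A s & theta R n * j%:R <= s < theta R n * j.+1%:R) ->
    (forall s k, A s -> normc (\sum_(i < k) c i * cis s ^+ i) <= M) ->
    (forall s, A s -> normc (cis s * (\sum_(i < N) c i * cis s ^+ i) - e%:C) <= delta) ->
    False.
Proof.
have [kappa [k0 kE]] : exists kappa : R, 0 < kappa /\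
    forall n (bad : pred 'I_n.+1) (z : R[i]), (5 <= n)%N -> normc z <= 1 ->
    barrier bad z <= kappa -> exists2 j : 'I_n.+1, ~~ bad j &
    forall s, theta R n * j%:R <= s < theta R n * j.+1%:R ->
    normc (cis s - z) <= 40 * (n.+1%:R^-1 + (1 - normc z)).
  have [c cE] : exists c : R, c = 21 by exists 21.
  have c0 : 0 < c by rewrite cE.
  exists (5 * c ^+ 2)^-1; split; first by rewrite invr_gt0 mulr_gt0// exprn_gt0.
  by move=> n bad z; exact: barrier_near.
have [h [h40 h0]] : exists h : R, h = 40 /\ 0 <= h by exists 40.
rewrite -h40 in kE.
(* Half of [kappa] keeps the barrier at the origin below [kappa / 2], hence [u 0] above [L / 2]. *)
exists (kappa / 2); first by rewrite divr_gt0.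
(* [B] bounds [G] on the cones: Abel summation gives [M] times [1 + 2 * h], and the constant term
   gives [e]. *)
move=> M e M0 e0; pose B := (1 + 2 * h) * M + e.
have B0 : 0 < B by rewrite ltr_wpDl// mulr_ge0// addr_ge0// mulr_ge0.
(* [L] makes [e * expR (L / 2)] exceed [B * expR 1], and [delta] is such that
   [2 * delta * expR L = B]. *)
pose L := 2 * (B * expR 1 / e).
have L0 : 0 < L by rewrite mulr_gt0// divr_gt0// mulr_gt0// expR_gt0.
pose delta := B * expR (- L) / 2.
have delta0 : 0 < delta by rewrite divr_gt0// mulr_gt0// expR_gt0.
exists delta => // c N A Abad AM Adelta.
pose F : {poly R[i]} := \sum_(i < N) (c i)%:P * 'X^i.
have FE z : F.[z] = \sum_(i < N) c i * z ^+ i.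
  by rewrite horner_sum; apply: eq_bigr => i _; rewrite hornerM hornerC hornerXn.
pose G : {poly R[i]} := 'X * F - (e%:C)%:P.
have GE z : G.[z] = z * (\sum_(i < N) c i * z ^+ i) - e%:C.
  by rewrite /G hornerD hornerN hornerM hornerX hornerC FE.
have [Lip Lip0 GLip] := horner_lip G.
(* [N <= n.+1] lets 1/K absorb the [N] terms of the geometric sum. The last condition makes passing
   from a point of [A] to a neighbour on the circle cost at most [delta]. *)
have [n [n5 nN nLip]] : exists n, [/\ (5 <= n)%N, (N <= n.+1)%N & Lip * (h * n.+1%:R^-1) <= delta].
  exists (5 + N + Num.truncn (delta^-1 * (Lip * h)))%N; split.
  - by rewrite -addnA leq_addr.
  - by apply: leqW; rewrite addnAC leq_addl.
  rewrite mulrA ler_pdivrMr ?ltr0n// -ler_pdivrMl//.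
  apply: ltW; apply: lt_le_trans (truncnS_gt _) _.
  by rewrite ler_nat ltnS leq_addl.
have [bad cbad badA] := Abad n.
(* [u] is nonnegative exactly where the barrier is at most [kappa], and there every point lies in a
   cone with vertex in [A]. *)
pose u z := L * (1 - kappa^-1 * barrier bad z).
have near z : normc z <= 1 -> 0 <= u z -> exists2 s, A s &
    normc (cis s - z) <= h * (n.+1%:R^-1 + (1 - normc z)).
  move=> z1; rewrite pmulr_rge0// subr_ge0 => qz.
  have [|j /badA[s As js] Hj] := kE n bad z n5 z1.
    by rewrite mulrC ler_pdivrMr// mul1r in qz.
  by exists s => //; exact: Hj.
have u0 : L / 2 <= u 0.
  rewrite /u ler_wpM2l ?(ltW L0)// barrier0.
  have : kappa^-1 * (#|bad|%:R / n.+1%:R) <= 1 / 2 :> R.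
    rewrite mulrC ler_pdivrMr// ler_pdivrMr ?ltr0n//.
    by rewrite div1r (mulrC _ kappa).
  by move: (_ * _) => x; lra.
have cont z : normc z <= 1 -> {for z, continuous u}.
  move=> z1; apply: (@cvgM _ _ (nbhs z) (nbhs_filter z)); first exact: cst_continuous.
  apply: (@cvgB _ _ _ (nbhs z) (nbhs_filter z)); first exact: cst_continuous.
  apply: (@cvgM _ _ (nbhs z) (nbhs_filter z)); first exact: cst_continuous.
  exact: barrier_continuous.
have flat z : normc z < 1 -> flat_at u z.
  move=> z1; apply: flatZ; apply: (flatD (flat_cst 1 z)).
  rewrite (_ : (fun _ => _) = fun x => - kappa^-1 * barrier bad x).
    by apply: flatZ; apply: barrier_flat; exact: ltW.
  by apply/funext => x; rewrite mulNr.
have level z : normc z <= 1 -> u z = 0 -> normc G.[z] <= B.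
  move=> z1 uz; have [|s As sz] := near z z1; first by rewrite uz.
  rewrite GE; apply: le_trans (normcD _ _) _; rewrite normcN normcR gtr0_norm// lerD2r normcM.
  apply: (@le_trans _ _ (normc (\sum_(i < N) c i * z ^+ i))).
    by rewrite ler_piMl ?normc_ge0.
  apply: le_trans (abel_bound N z1 M0 (fun k => AM s k As)) _.
  rewrite (mulrC _ M) ler_wpM2l// lerD2l.
  have [|S1 S2] := @geo_sum_le R (normc z) N; first by rewrite normc_ge0.
  set S := \sum_(i < N) _ in S1 S2 *.
  have S0 : 0 <= S by apply: sumr_ge0 => i _; rewrite exprn_ge0 ?normc_ge0.
  apply: le_trans (ler_wpM2r S0 sz) _; rewrite -mulrA (mulrC 2) ler_wpM2l// mulrDl.
  have : n.+1%:R^-1 * S <= 1.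
    rewrite mulrC ler_pdivrMr ?ltr0n// mul1r; apply: le_trans S1 _.
    by rewrite ler_nat.
  by move: (_ * _) (_ * _) S2 => x y; lra.
have bdry z : normc z = 1 -> 0 < u z -> normc G.[z] * expR (u z) <= B.
  move=> z1 uz; have zle : normc z <= 1 by rewrite z1.
  have [s As sz] := near z zle (ltW uz).
  rewrite z1 subrr addr0 in sz.
  have Gs : normc G.[z] <= 2 * delta.
    have -> : G.[z] = G.[cis s] - (G.[cis s] - G.[z]) by ring.
    apply: le_trans (normcD _ _) _; rewrite normcN mulr_natl mulr2n; apply: lerD.
      by rewrite GE; exact: Adelta.
    apply: le_trans (GLip _ _ _ _) _; rewrite ?normc_cis ?z1//.
    by apply: le_trans nLip; exact: ler_wpM2l.
  have -> : B = 2 * delta * expR L.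
    rewrite /delta expRN; field; rewrite gt_eqF ?expR_gt0//.
  apply: ler_pM; rewrite ?normc_ge0 ?expR_ge0// ler_expR /u.
  rewrite -[leRHS]mulr1 ler_wpM2l ?(ltW L0)// gerBl mulr_ge0 ?invr_ge0 ?(ltW k0)//.
  by rewrite barrier_ge0// z1.
have := max_principle (ltW B0) cont flat level bdry.
have -> : normc G.[0] = e by rewrite GE mul0r sub0r normcN normcR gtr0_norm.
move=> H; have {}H : e * expR (u 0) <= B * expR 1.
  by apply: H; apply: le_trans u0; rewrite divr_ge0// ltW.
have : e * (1 + B * expR 1 / e) <= B * expR 1.
  apply: le_trans H; rewrite ler_wpM2l ?(ltW e0)//; apply: le_trans (expR_ge1Dx _) _.
  have <- : L / 2 = B * expR 1 / e by rewrite /L; field; rewrite gt_eqF.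
  by rewrite ler_expR.
by rewrite mulrDr mulr1 mulrCA divff ?gt_eqF// mulr1 gerDr leNgt e0.
Qed.

(** * Exceptional sets and nowhere density *)

Section measure.
Variable R : realType.
Local Notation C := R[i].
Local Notation mu := (@lebesgue_measure R).
Local Notation I := (`[0, 2 * pi[%classic : set (measurableTypeR R)).

(** The bad arcs are those contained in [X]. They are disjoint and of length [theta R n], so their
    number is at most the measure of [X] divided by that length. *)
Lemma grid_bad (X : set (measurableTypeR R)) (kappa : R) :
  measurable X -> (mu X <= (kappa * (2 * pi))%:E)%E ->
  forall n, exists2 bad : pred 'I_n.+1, #|bad|%:R <= kappa * n.+1%:R :> R &
    forall j, ~~ bad j -> exists2 s, (I `\` X) s &
      theta R n * j%:R <= s < theta R n * j.+1%:R.
Proof.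
move=> mX muX n; pose arc (j : 'I_n.+1) : set (measurableTypeR R) :=
  `[theta R n * j%:R, theta R n * j.+1%:R[%classic.
have K0 : 0 < n.+1%:R :> R by rewrite ltr0n.
have pi2 : 0 < 2 * pi :> R by rewrite mulr_gt0 ?pi_gt0.
have th0 : 0 < theta R n by rewrite divr_gt0.
exists (fun j => `[< arc j `<=` X >]).
  have marc j : mu (arc j) = (theta R n)%:E.
    rewrite lebesgue_measure_itv /= lte_fin ltr_pM2l// ltr_nat ltnSn.
    by rewrite -EFinB -mulrBr -natrB// subSnn mulr1.
  have tarc : trivIset setT arc.
    apply/trivIsetP => i j _ _ ij; apply/seteqP; split=> // x [].
    rewrite /arc /= !in_itv /= => /andP[i1 i2] /andP[j1 j2].
    have := le_lt_trans i1 j2; have := le_lt_trans j1 i2.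
    rewrite !ltr_pM2l// !ltr_nat !ltnS => ji ij'; move/eqP: ij; apply.
    by apply/val_inj/eqP; rewrite eqn_leq ij' ji.
  have : (mu (\big[setU/set0]_(j < n.+1 | `[< arc j `<=` X >]) arc j) <= mu X)%E.
    apply: le_measure; rewrite ?inE//.
      by apply: bigsetU_measurable => j _; exact: measurable_itv.
    apply: (big_ind (fun Y => Y `<=` X)) => // [A B AX BX x [/AX|/BX]//|j /asboolP//].
  rewrite measure_bigsetU_ord//; last by move=> j; exact: measurable_itv.
  rewrite (eq_bigr (fun=> (theta R n)%:E)); last by move=> j _; exact: marc.
  rewrite sumEFin sumr_const => /le_trans/(_ muX); rewrite lee_fin -[leLHS]mulr_natr.
  by rewrite /theta mulrAC ler_pdivrMr// (mulrC kappa) -[leRHS]mulrA ler_pM2l.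
move=> j /asboolPn/existsNP[s /not_implyP[sj Xs]].
have := sj; rewrite /arc /= in_itv /= => sj'; exists s => //; split=> //.
case/andP: sj' => s1 s2; rewrite /= in_itv /=; apply/andP; split.
  by apply: le_trans s1; rewrite mulr_ge0// ltW.
apply: lt_le_trans s2 _; rewrite /theta mulrAC ler_pdivrMr// ler_pM2l//.
by rewrite ler_nat.
Qed.

(** Continuity of the measure from above. Applied to [exceed] and [far], it gives Egorov-type
    statements: bounds valid almost everywhere become uniform off a set of measure at most [eta]. *)
Lemma measure_tail (F : (set (measurableTypeR R))^nat) (eta : R) : 0 < eta ->
  (forall n, measurable (F n)) -> (forall n, F n `<=` I) -> nonincreasing_seq F ->
  mu.-negligible (\bigcap_n F n) -> exists n, (mu (F n) <= eta%:E)%E.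
Proof.
move=> eta0 mF FI dF F0.
have mI : measurable (\bigcap_n F n) by exact: bigcapT_measurable.
have F0oo : (mu (F 0%N) < +oo)%E.
  apply: (@le_lt_trans _ _ (mu I)); first by rewrite le_measure ?inE//; exact: measurable_itv.
  by rewrite lebesgue_measure_itv /=; case: ifP => // _; rewrite -EFinB ltry.
have E : mu (\bigcap_n F n) = 0%E by exact/(negligibleP _ mI).
have : (mu \o F) @ \oo --> 0%E.
  by rewrite -E; exact: (nonincreasing_cvg_mu F0oo mF mI dF).
move=> /fine_cvgP[[N _ fN] /cvgrPdist_le/(_ _ eta0)[N' _ hN]].
exists (maxn N N'); have := hN (maxn N N') (leq_maxr _ _).
have fin := fN (maxn N N') (leq_maxl _ _).
by rewrite /= sub0r normrN => /(le_trans (ler_norm _)); rewrite -lee_fin fineK.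
Qed.

Definition psum (c : nat -> C) (k : nat) (x : R) : C := \sum_(i < k) c i * cis x ^+ i.

Lemma cis_continuous : continuous (@cis R).
Proof.
move=> x A /nbhs_normcP[r r0 rA].
exists (r / 2); first by rewrite /= divr_gt0.
move=> y /= xy; apply: rA; apply: le_lt_trans (cis_lip _ _) _.
by rewrite distrC mulrC -ltr_pdivlMr.
Qed.

Lemma psum_continuous c k : continuous (psum c k).
Proof.
have -> : psum c k = (fun z : C => (\sum_(i < k) (c i)%:P * 'X^i).[z]) \o @cis R.
  apply/funext => x; rewrite /psum /= horner_sum; apply: eq_bigr => i _.
  by rewrite hornerM hornerC hornerXn.
by move=> x; apply: continuous_comp; [exact: cis_continuous|exact: horner_cplx_continuous].
Qed.

Lemma psumB c d k x : psum (fun i => c i - d i) k x = psum c k x - psum d k x.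
Proof. by rewrite /psum -sumrB; apply: eq_bigr => i _; rewrite mulrBl. Qed.

Lemma series_psum c k x : series (fun n => c n * expi n (toT x)) k = psum c k x.
Proof.
by rewrite /series /= big_mkord; apply: eq_bigr => i _; rewrite expi_toT -cis_muln.
Qed.

Lemma cvgn_normcP (u : nat -> C) (l : C) : u @ \oo --> l <->
  forall e : R, 0 < e -> exists N, forall k, (N <= k)%N -> normc (u k - l) < e.
Proof.
split=> [ul e e0|ul A /nbhs_normcP[r r0 rA]].
  have /ul : nbhs l [set w | normc (w - l) < e] by apply/nbhs_normcP; exists e.
  by case=> N _ NA; exists N => k Nk; exact: NA.
by have [N Nr] := ul _ r0; exists N => // k Nk; apply: rA; exact: Nr.
Qed.

Lemma cvgn_bounded (u : nat -> C) (l : C) : u @ \oo --> l ->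
  exists M : nat, forall k, normc (u k) <= M%:R.
Proof.
move=> /cvgn_normcP/(_ 1 ltr01)[N Nl].
have [M MN] : exists M : R, forall k, (k < N)%N -> normc (u k) <= M.
  exists (\sum_(i < N) normc (u i)) => k kN.
  rewrite (bigD1 (Ordinal kN)) //= lerDl sumr_ge0// => i _; exact: normc_ge0.
exists (Num.truncn (Num.max M (normc l + 1))).+1 => k; apply/ltW.
apply: le_lt_trans (truncnS_gt _); rewrite le_max.
have [kN|kN] := ltnP k N; first by rewrite MN.
apply/orP; right; have := Nl _ kN; have := normc_sub (u k) l; lra.
Qed.

Definition exceed (c : nat -> C) (M : R) : set (measurableTypeR R) :=
  I `&` [set x | exists k, M < normc (psum c k x)].

(** All indices from [N] on are included, so the sets decrease in [N] and a single later index can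
    serve two series at once. *)
Definition far (c : nat -> C) (f : CT R) (delta : R) (N : nat) : set (measurableTypeR R) :=
  I `&` [set x | exists2 k, (N <= k)%N & delta < normc (psum c k x - f (toT x))].

Lemma gt_measurable (g : R -> R) (a : R) : continuous g ->
  measurable ([set x | a < g x] : set (measurableTypeR R)).
Proof.
move=> cg; apply: open_measurable.
rewrite (_ : [set x | _] = g @^-1` [set y | a < y])//.
by apply: open_comp; [move=> x _; exact: cg|exact: open_gt].
Qed.

Lemma exceed_measurable c M : measurable (exceed c M).
Proof.
apply: measurableI; first exact: measurable_itv.
rewrite (_ : [set x | _] = \bigcup_k [set x | M < normc (psum c k x)]); last first.
  by apply/seteqP; split=> x [k]; [exists k|move=> _; exists k].
apply: bigcupT_measurable => k; apply: gt_measurable => x.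
apply: (@continuous_comp _ _ _ (psum c k) (@normc R)); first exact: psum_continuous.
exact: normc_continuous.
Qed.

Lemma far_measurable c f delta N : measurable (far c f delta N).
Proof.
apply: measurableI; first exact: measurable_itv.
rewrite (_ : [set x | _] = \bigcup_(k in [set k | (N <= k)%N])
   [set x | delta < normc (psum c k x - f (toT x))]); last first.
  by apply/seteqP; split=> x [k Nk]; exists k.
apply: bigcup_measurable => k _; apply: gt_measurable => x.
apply: (@continuous_comp _ _ _ (fun x => psum c k x - f (toT x)) (@normc R)); last first.
  exact: normc_continuous.
apply: (@cvgB _ _ _ (nbhs x) (nbhs_filter x)); first exact: psum_continuous.
by apply: (@continuous_comp _ _ _ (@toT R) f); [exact: toT_continuous|exact: CT_continuous].
Qed.

Definition represents (c : nat -> C) (f : circle R -> C) :=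
  {ae @circle_measure R, forall t, series (fun n => c n * expi n t) @ \oo --> f t}.

Lemma representsP c f : represents c f ->
  {ae mu, forall x, x \in `[0, 2 * pi[ -> (fun k => psum c k x) @ \oo --> f (toT x)}.
Proof.
move=> /ae_circleP; apply: negligibleS => x /=; apply: contra_not => H Ix.
rewrite (_ : (fun k => psum c k x) = series (fun n => c n * expi n (toT x))); first exact: H.
by apply/funext => k; rewrite series_psum.
Qed.

Lemma exceed_tail c f (eta : R) : represents c f -> 0 < eta ->
  exists M : nat, (mu (exceed c M%:R) <= eta%:E)%E.
Proof.
move=> /representsP cf eta0; apply: (@measure_tail (fun M => exceed c M%:R)) => //.
- by move=> M; exact: exceed_measurable.
- by move=> M x [].
- apply/nonincreasing_seqP => M; apply/subsetPset => x [Ix [k kx]]; split=> //.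
  by exists k; apply: lt_trans kx; rewrite ltr_nat.
apply: negligibleS cf => x Hx /= cx.
have [Ix _] := Hx 0%N Logic.I; have [M Mx] := cvgn_bounded (cx Ix).
by have [_ [k]] := Hx M Logic.I; rewrite ltNge Mx.
Qed.

Lemma far_tail c (f : CT R) (delta eta : R) : represents c f -> 0 < delta -> 0 < eta ->
  exists N : nat, (mu (far c f delta N) <= eta%:E)%E.
Proof.
move=> /representsP cf d0 eta0; apply: (@measure_tail (far c f delta)) => //.
- by move=> M; exact: far_measurable.
- by move=> M x [].
- apply/nonincreasing_seqP => N; apply/subsetPset => x [Ix [k kx]]; split=> //.
  by exists k => //; exact: ltnW.
apply: negligibleS cf => x Hx /= cx.
have [Ix _] := Hx 0%N Logic.I; have /cvgn_normcP/(_ _ d0)[N Nx] := cx Ix.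
by have [_ [k /Nx]] := Hx N Logic.I; move=> /lt_trans h /h; rewrite ltxx.
Qed.


(** * Classes of functions with bounded partial sums *)

(** The bound [M] is an integer, to get countably many classes. [eta] is the same for all of them,
    so a larger [M] never calls for a smaller exceptional set. *)
Definition bounded_class (eta : R) (M : nat) : set (CT R) :=
  [set f | exists2 c, represents c f & (mu (exceed c M%:R) <= eta%:E)%E].

Lemma conj_cis_repr x : cos (repr (toT x)) -i* sin (repr (toT x)) = cis (- x) :> C.
Proof.
have [k ->] : exists k : int, repr (toT x) = x + k%:~R * (2 * pi).
  by apply/toT_eq; exact: reprK.
rewrite /cis cosN sinN (_ : 2 * pi = pi *+ 2) ?mulr_natl//.
by rewrite (periodicz (@cosD2pi R)) (periodicz (@sinD2pi R)).
Qed.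

Lemma expNi_continuous : continuous
  (fun t : circle R => cos (repr t) -i* sin (repr t) : C).
Proof.
apply/quotient_continuous => x.
rewrite (_ : _ \o _ = fun x => cis (- x)); last first.
  by apply/funext => y; exact: conj_cis_repr.
apply: (@continuous_comp _ _ _ (fun x : R => - x) (@cis R)); last exact: cis_continuous.
exact: opp_continuous.
Qed.

(** The first negative frequency: multiplied by [cis s] it becomes the constant 1, whereas an
    analytic sum multiplied by [z] vanishes at the origin. *)
Definition expNi : CT R := mkCT expNi_continuous.

Lemma expNi_toT x : expNi (toT x) = cis (- x).
Proof. exact: conj_cis_repr. Qed.

Lemma nbhs_CTP (f : CT R) (A : set (CT R)) :
  nbhs f A <-> exists2 r : R, 0 < r & forall g, unorm (g - f) < r -> A g.
Proof.
have unormB (g h : CT R) : unorm (g - h) = unorm (h - g).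
  by apply: complexI; rewrite -!CT_normE distrC.
split.
  move/nbhs_ballP => [[e e'] /= e0 fA].
  move: e0; rewrite ltcE /= => /andP[/eqP e'0 e0]; exists e => // g gf; apply: fA.
  by rewrite -ball_normE /ball_ /= CT_normE e'0 ltcR unormB.
case=> r r0 rA; apply/nbhs_ballP; exists r%:C; first by rewrite /= ltcR.
by move=> g; rewrite -ball_normE /ball_ /= CT_normE ltcR unormB => /rA.
Qed.

Lemma bounded_class_nowhere_dense : exists2 eta : R, 0 < eta &
  forall M, nowhere_dense (bounded_class eta M).
Proof.
have [kappa k0 gap] := analytic_gap R.
have pi2 : 0 < 2 * pi :> R by rewrite mulr_gt0 ?pi_gt0.
(* A quarter, because four exceptional sets are united below: one [exceed] and one [far] for each of
   two functions. *)
pose eta := kappa * (2 * pi) / 4.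
have eta0 : 0 < eta by rewrite divr_gt0// mulr_gt0.
exists eta => // M; apply/seteqP; split => // f' f'int.
have f'cl : closure (bounded_class eta M) f' := interior_subset f'int.
(* [f'] itself may lie outside the class; a member [f] in the same open set replaces it. *)
have [f [[c cf cM] fint]] := f'cl _ (nbhs_interior f'int).
have /nbhs_CTP[r r0 rcl] := fint; rewrite /set0 /=.
pose e := r / 2; have e0 : 0 < e by rewrite divr_gt0.
(* The bound is [M + M] because the gap estimate is applied to a difference of two series. *)
have [delta delta0 {}gap] := gap (M%:R + M%:R) e (addr_ge0 (ler0n _ _) (ler0n _ _)) e0.
pose g : CT R := f + e%:C *: expNi.
have gE x : g (toT x) = f (toT x) + e%:C * cis (- x) by rewrite -expNi_toT.
have gcl : closure (bounded_class eta M) g.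
  apply: rcl; rewrite /g addrAC subrr add0r; apply: le_lt_trans (_ : _ <= e) _.
    apply: unorm_le => t; have [x _ <-] := toT_surj t.
    rewrite [X in normc X](_ : _ = e%:C * cis (- x)); last by rewrite -expNi_toT.
    by rewrite normcM normc_cis mulr1 normcR gtr0_norm.
  by rewrite /e; lra.
(* Three errors are added: the series [d] against [h], [h] against [g], and the series [c] against
   [f]. *)
have d30 : 0 < delta / 3 by rewrite divr_gt0.
have [|h [[d dh dM] hg]] := gcl [set h | unorm (h - g) < delta / 3].
  by apply/nbhs_CTP; exists (delta / 3).
have [N1 muN1] := far_tail cf d30 eta0.
have [N2 muN2] := far_tail dh d30 eta0.
pose X := (exceed c M%:R `|` exceed d M%:R) `|`
  (far c f (delta / 3) N1 `|` far d h (delta / 3) N2).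
have mX : measurable X.
  by do 2?apply: measurableU; (exact: exceed_measurable || exact: far_measurable).
have muX : (mu X <= (kappa * (2 * pi))%:E)%E.
  have -> : kappa * (2 * pi) = (eta + eta) + (eta + eta) by rewrite /eta; lra.
  rewrite !EFinD; apply: le_trans (measureU2 _ _ _) _.
  - by apply: measurableU; exact: exceed_measurable.
  - by apply: measurableU; exact: far_measurable.
  apply: leeD; (apply: le_trans (measureU2 _ _ _) _; last exact: leeD);
    (exact: exceed_measurable || exact: far_measurable).
pose N := maxn N1 N2.
apply: (gap (fun i => d i - c i) N (I `\` X)); first exact: grid_bad.
  move=> s k [Is Xs]; have := psumB d c k s; rewrite {1}/psum => ->.
  apply: le_trans (normcD _ _) _; rewrite normcN; apply: lerD; rewrite leNgt;
    apply/negP => H; apply: Xs; left; [right|left]; split=> //; exists k; exact: H.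
move=> s [Is Xs]; have := psumB d c N s; rewrite {1}/psum => ->.
have hd : normc (psum d N s - h (toT s)) <= delta / 3.
  rewrite leNgt; apply/negP => H; apply: Xs; right; right; split=> //.
  by exists N => //; exact: leq_maxr.
have fc : normc (psum c N s - f (toT s)) <= delta / 3.
  rewrite leNgt; apply/negP => H; apply: Xs; right; left; split=> //.
  by exists N => //; exact: leq_maxl.
have gh : normc (h (toT s) - g (toT s)) <= delta / 3.
  by apply: le_trans (ltW hg); exact: (le_unorm (h - g)).
(* The term [e%:C] is rewritten as [cis s] times the perturbation [g - f], which leaves only the
   three errors. *)
have -> : cis s * (psum d N s - psum c N s) - e%:C =
    cis s * ((psum d N s - h (toT s)) + (h (toT s) - g (toT s)) - (psum c N s - f (toT s))).
  have cc : cis s * cis (- s) = 1 by rewrite -cisD subrr /cis cos0 sin0.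
  rewrite gE -[X in _ - X]mulr1 -cc; ring.
rewrite normcM normc_cis mul1r.
apply: le_trans (normcD _ _) _; rewrite normcN.
have := normcD (psum d N s - h (toT s)) (h (toT s) - g (toT s)); lra.
Qed.

End measure.

Theorem theorem3 (R : realType) :
  first_category [set f : CT R | PLA R f].
Proof.
have [eta eta0 nd] := @bounded_class_nowhere_dense R.
exists (bounded_class eta); split=> //.
(* Equality holds because members of a class are represented functions by definition; conversely
   [exceed_tail], at the fixed [eta], finds an [M] for each represented [f]. *)
apply/seteqP; split=> [f [c cf]|f [M _ [c cf _]]]; last by exists c.
by have [M cM] := exceed_tail cf eta0; exists M => //; exists c.
Qed.
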